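(* Let $R$ be a skew-invertible Hecke symmetry and let $L(u)$ be the generating matrix of the braided Yangian $\mathbf{Y}(R)$. The skew-symmetric powers $L^{\wedge k}(u)$ and the matrix powers $L^{[k]}(u)$ of $L(u)$ satisfy the Cayley-Hamilton-Newton identities $$(-1)^{k+1}k_q\,L^{\wedge k}(u)=\sum_{p=0}^{k-1}(-q)^p\,L^{[k-p]}(q^{-2p}u)\,e_p(u),\qquad k\ge1.$$
   Context: Conventions. $V$ is an $N$-dimensional vector space over $\mathbb{K}=\mathbb{R}$ or $\mathbb{C}$ with a fixed basis $\{x_i\}$. An operator $R$ on $V^{\otimes 2}$ has matrix given by $R(x_i\otimes x_j)=R_{ij}^{ks}x_k\otimes x_s$ (summation over repeated indices); matrix products are $(AB)_i^j=A_i^kB_k^j$. $R_k=R_{k\,k+1}$ is $R$ acting in tensor factors $k,k+1$; lower indices on operators indicate the tensor factors where they act; $L_1=L\otimes I$. Hecke symmetry: $R$ satisfies $R_{12}R_{23}R_{12}=R_{23}R_{12}R_{23}$ and $(qI-R)(q^{-1}I+R)=0$, with $q\in\mathbb{K}$ nonzero and generic ($q^n\neq 1$ for all nonzero integers $n$). Put $k_q=\frac{q^k-q^{-k}}{q-q^{-1}}$. Skew-invertible: there is $\Psi$ on $V^{\otimes 2}$ with $R_{ij}^{kl}\Psi_{lp}^{jq'}=\delta_i^{q'}\delta_p^k$. Put $C_i^j=\Psi_{ik}^{jk}$; $\mathrm{Tr}_R(X)=\mathrm{Tr}(XC)=C_i^jX_j^i$ for a matrix $X$ with entries in any algebra, and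 $\mathrm{Tr}_{R(a\dots b)}$ is the $R$-trace over tensor factors $a,\dots,b$. Skew-symmetrizers: $\mathcal{P}^{(1)}=I$, $\mathcal{P}^{(k+1)}_{1\dots k+1}=\frac{k_q}{(k+1)_q}\mathcal{P}^{(k)}_{1\dots k}\big(\frac{q^k}{k_q}I-R_k\big)\mathcal{P}^{(k)}_{1\dots k}$. Braided Yangian: let $R(u,v)=R-\frac{u(q-q^{-1})}{u-v}I$. $\mathbf{Y}(R)$ is the unital associative algebra generated by the entries $l_i^j[k]$ ($k\ge1$) of matrices $L[k]$, where $L(u)=\sum_{k\ge0}L[k]u^{-k}$, $L[0]=I$, subject to the relations obtained by expanding $R(u,v)L_1(u)RL_1(v)=L_1(v)RL_1(u)R(u,v)$. Notation: $L_{\overline1}(u)=L_1(u)$, $L_{\overline{k+1}}(u)=R_kL_{\overline k}(u)R_k^{-1}$. Elementary symmetric polynomials: $e_0(u)=1$, $e_k(u)=\mathrm{Tr}_{R(1\dots k)}\big(\mathcal{P}^{(k)}_{1\dots k}L_{\overline1}(u)L_{\overline2}(q^{-2}u)\cdots L_{\overline k}(q^{-2(k-1)}u)\big)$ for $k\ge1$. Skew-symmetric powers: $L^{\wedge1}(u)=L(u)$, $L^{\wedge k}(u)=\mathrm{Tr}_{R(2\dots k)}\big(\mathcal{P}^{(k)}_{1\dots k}L_{\overline1}(u)L_{\overline2}(q^{-2}u)\cdots L_{\overline k}(q^{-2(k-1)}u)\big)$ for $k\ge2$. Matrix powers: $L^{[k]}(u)=\mathrm{Tr}_{R(2\dots k)}\big(L_{\overline1}(q^{-2(k-1)}u)L_{\overline2}(q^{-2(k-2)}u)\cdots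 L_{\overline k}(u)R_{k-1}\cdots R_2R_1\big)$, $k\ge1$; this equals $L(q^{-2(k-1)}u)L(q^{-2(k-2)}u)\cdots L(u)$. *)

(* Defs.v *)
From HB Require Import structures.
From mathcomp Require Import all_boot all_order all_algebra.
From mathcomp Require Import boolp.
From mathcomp.finmap Require finmap.
From mathcomp.multinomials Require Import monalg.

Set Implicit Arguments.
Unset Strict Implicit.
Unset Printing Implicit Defensive.

Import GRing.Theory.
Local Open Scope ring_scope.
Local Open Scope quotient_scope.

(* A term [Fps f] of [fps A] is the formal series \sum_k (f k) u^(-k) in the
   inverse of a central formal variable u. *)
Record fps (A : Type) : Type := Fps { fcoef : nat -> A }.

HB.instance Definition _ (A : Type) := gen_eqMixin (fps A).
HB.instance Definition _ (A : Type) := gen_choiceMixin (fps A).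

Lemma fpsP (A : Type) (f g : fps A) : fcoef f =1 fcoef g -> f = g.
Proof. by case: f g => [f] [g] /= /funext ->. Qed.

Section FpsZmod.
Variable A : zmodType.

Definition fps_zero : fps A := Fps (fun=> 0).
Definition fps_opp (f : fps A) := Fps (fun k => - fcoef f k).
Definition fps_add (f g : fps A) := Fps (fun k => fcoef f k + fcoef g k).

Fact fps_addA : associative fps_add.
Proof. by move=> f g h; apply: fpsP => k /=; rewrite addrA. Qed.
Fact fps_addC : commutative fps_add.
Proof. by move=> f g; apply: fpsP => k /=; rewrite addrC. Qed.
Fact fps_add0 : left_id fps_zero fps_add.
Proof. by move=> f; apply: fpsP => k /=; rewrite add0r. Qed.
Fact fps_addN : left_inverse fps_zero fps_opp fps_add.
Proof. by move=> f; apply: fpsP => k /=; rewrite addNr. Qed.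

HB.instance Definition _ :=
  GRing.isZmodule.Build (fps A) fps_addA fps_addC fps_add0 fps_addN.

Lemma fcoef0 k : fcoef (0 : fps A) k = 0. Proof. by []. Qed.
Lemma fcoefD (f g : fps A) k : fcoef (f + g) k = fcoef f k + fcoef g k.
Proof. by []. Qed.
Lemma fcoefN (f : fps A) k : fcoef (- f) k = - fcoef f k. Proof. by []. Qed.
Lemma fcoef_sum (I : Type) (r : seq I) (P : pred I) (F : I -> fps A) k :
  fcoef (\sum_(i <- r | P i) F i) k = \sum_(i <- r | P i) fcoef (F i) k.
Proof. exact: (big_morph (fun f : fps A => fcoef f k)). Qed.

End FpsZmod.

HB.lock Definition fps_mul (A : nzRingType) (f g : fps A) : fps A :=
  Fps (fun k => \sum_(i < k.+1) fcoef f i * fcoef g (k - i)%N).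
Arguments fps_mul {A} f g.

Section FpsRing.
Variable A : nzRingType.

Definition fps_const (a : A) : fps A := Fps (fun k => if k == 0%N then a else 0).
(* The inverse u^(-1) of the formal variable. *)
Definition fps_uinv : fps A := Fps (fun k => (k == 1%N)%:R).

Lemma fcoef_mul (f g : fps A) k :
  fcoef (fps_mul f g) k = \sum_(i < k.+1) fcoef f i * fcoef g (k - i)%N.
Proof. by rewrite fps_mul.unlock. Qed.

Lemma fps_mul_rev (f g : fps A) k :
  fcoef (fps_mul f g) k = \sum_(i < k.+1) fcoef f (k - i)%N * fcoef g i.
Proof.
rewrite fcoef_mul (reindex_inj rev_ord_inj) /=.
by apply: eq_bigr => i _; rewrite (sub_ordK i).
Qed.

Fact fps_mulA : associative (@fps_mul A).
Proof.
move=> p q r; apply: fpsP => i.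
pose coef3 j k := fcoef p j * (fcoef q (i - j - k)%N * fcoef r k).
transitivity (\sum_(j < i.+1) \sum_(k < i.+1 | (k <= i - j)%N) coef3 j k).
  rewrite fcoef_mul; apply: eq_bigr => /= j _; rewrite fps_mul_rev.
  by rewrite big_distrr /= (big_ord_narrow_leq (leq_subr _ _)).
rewrite fps_mul_rev (exchange_big_dep predT) //=; apply: eq_bigr => k _.
transitivity (\sum_(j < i.+1 | (j <= i - k)%N) coef3 j k).
  apply: eq_bigl => j; rewrite -ltnS -(ltnS j) -!subSn ?leq_ord //.
  by rewrite -subn_gt0 -(subn_gt0 j) -!subnDA addnC.
rewrite (big_ord_narrow_leq (leq_subr _ _)) /=.
rewrite fcoef_mul big_distrl; apply: eq_bigr => j _ /=.
by rewrite /coef3 -!subnDA addnC mulrA.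
Qed.

Fact fps_mul1 : left_id (fps_const 1) (@fps_mul A).
Proof.
move=> f; apply: fpsP => k; rewrite fcoef_mul.
rewrite big_ord_recl /= subn0 mul1r big1 ?addr0 // => i _.
by rewrite mul0r.
Qed.

Fact fps_mulr1 : right_id (fps_const 1) (@fps_mul A).
Proof.
move=> f; apply: fpsP => k; rewrite fps_mul_rev.
rewrite big_ord_recl /= subn0 mulr1 big1 ?addr0 // => i _.
by rewrite mulr0.
Qed.

Fact fps_mulDl : left_distributive (@fps_mul A) +%R.
Proof.
move=> f g h; apply: fpsP => k; rewrite /= !fcoef_mul -big_split /=.
by apply: eq_bigr => i _; rewrite mulrDl.
Qed.

Fact fps_mulDr : right_distributive (@fps_mul A) +%R.
Proof.
move=> f g h; apply: fpsP => k; rewrite /= !fcoef_mul -big_split /=.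
by apply: eq_bigr => i _; rewrite mulrDr.
Qed.

Fact fps_oner_neq0 : fps_const 1 != 0.
Proof.
apply/eqP => /(congr1 (fun f : fps A => fcoef f 0)) /= /eqP.
by rewrite oner_eq0.
Qed.

HB.instance Definition _ := GRing.Zmodule_isNzRing.Build (fps A)
  fps_mulA fps_mul1 fps_mulr1 fps_mulDl fps_mulDr fps_oner_neq0.

Lemma fcoefM (f g : fps A) k :
  fcoef (f * g) k = \sum_(i < k.+1) fcoef f i * fcoef g (k - i)%N.
Proof. exact: fcoef_mul. Qed.
Lemma fcoef1 k : fcoef (1 : fps A) k = (k == 0%N)%:R.
Proof. by rewrite /=; case: (k == 0%N). Qed.

End FpsRing.

Section FpsAlg.
Variables (K : comNzRingType) (A : algType K).

Definition fps_scale (c : K) (f : fps A) : fps A :=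
  Fps (fun k => c *: fcoef f k).

Fact fps_scaleA a b f : fps_scale a (fps_scale b f) = fps_scale (a * b) f.
Proof. by apply: fpsP => k /=; rewrite scalerA. Qed.
Fact fps_scale1 : left_id 1 fps_scale.
Proof. by move=> f; apply: fpsP => k /=; rewrite scale1r. Qed.
Fact fps_scaleDr : right_distributive fps_scale +%R.
Proof. by move=> c f g; apply: fpsP => k /=; rewrite scalerDr. Qed.
Fact fps_scaleDl f : {morph fps_scale^~ f : a b / a + b}.
Proof. by move=> a b; apply: fpsP => k /=; rewrite scalerDl. Qed.

HB.instance Definition _ := GRing.Zmodule_isLmodule.Build K (fps A)
  fps_scaleA fps_scale1 fps_scaleDr fps_scaleDl.

Fact fps_scaleAl (c : K) (f g : fps A) : c *: (f * g) = (c *: f) * g.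
Proof.
apply: fpsP => k; rewrite /= !fcoefM scaler_sumr.
by apply: eq_bigr => i _; rewrite scalerAl.
Qed.

HB.instance Definition _ := GRing.Lmodule_isLalgebra.Build K (fps A) fps_scaleAl.

Fact fps_scaleAr (c : K) (f g : fps A) : c *: (f * g) = f * (c *: g).
Proof.
apply: fpsP => k; rewrite /= !fcoefM scaler_sumr.
by apply: eq_bigr => i _; rewrite scalerAr.
Qed.

HB.instance Definition _ := GRing.Lalgebra_isAlgebra.Build K (fps A) fps_scaleAr.

Lemma fcoefZ c (f : fps A) k : fcoef (c *: f) k = c *: fcoef f k.
Proof. by []. Qed.

End FpsAlg.

(* f(u) |-> f(c u). *)
Definition fps_dilate (K : fieldType) (A : algType K) (c : K) (f : fps A) :
  fps A := Fps (fun k => c ^- k *: fcoef f k).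

Definition fps_map (A B : Type) (g : A -> B) (f : fps A) : fps B :=
  Fps (fun k => g (fcoef f k)).

Section FpsMap.
Variables (A B : nzRingType) (g : {rmorphism A -> B}).

Fact fps_map_is_zmod_morphism : zmod_morphism (fps_map g).
Proof. by move=> x y; apply: fpsP => k /=; rewrite rmorphB. Qed.
Fact fps_map_is_monoid_morphism : monoid_morphism (fps_map g).
Proof.
split=> [|x y]; apply: fpsP => k /=.
  by case: ifP => _; rewrite ?rmorph1 ?rmorph0.
by rewrite !fcoefM rmorph_sum; apply: eq_bigr => i _; rewrite rmorphM.
Qed.
HB.instance Definition _ := GRing.isZmodMorphism.Build (fps A) (fps B)
  (fps_map g) fps_map_is_zmod_morphism.
HB.instance Definition _ := GRing.isMonoidMorphism.Build (fps A) (fps B)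
  (fps_map g) fps_map_is_monoid_morphism.

Lemma fps_map_const a : fps_map g (fps_const a) = fps_const (g a).
Proof. by apply: fpsP => k /=; case: ifP => _; rewrite ?rmorph0. Qed.
Lemma fps_map_uinv : fps_map g (fps_uinv A) = fps_uinv B.
Proof. by apply: fpsP => k /=; rewrite rmorph_nat. Qed.

End FpsMap.

Section TwoSidedIdeal.
Variables (K : fieldType) (A : algType K).

Inductive ideal_gen (S : A -> Prop) : A -> Prop :=
| Ideal0 : ideal_gen S 0
| IdealMD a s b x : S s -> ideal_gen S x -> ideal_gen S (a * s * b + x).

Section Quotient.
Variable S : A -> Prop.
Hypothesis proper : ~ ideal_gen S 1.

Lemma ideal_genD x y : ideal_gen S x -> ideal_gen S y -> ideal_gen S (x + y).
Proof.
by move=> Sx Sy; elim: Sx => [|a s b z Ss _ IH]; rewrite ?add0r // -addrA; right.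
Qed.
Lemma ideal_genMl c x : ideal_gen S x -> ideal_gen S (c * x).
Proof.
elim=> [|a s b z Ss _ IH]; first by rewrite mulr0; left.
by rewrite mulrDr !mulrA; right.
Qed.
Lemma ideal_genMr c x : ideal_gen S x -> ideal_gen S (x * c).
Proof.
elim=> [|a s b z Ss _ IH]; first by rewrite mul0r; left.
by rewrite mulrDl -mulrA; right.
Qed.
Lemma ideal_genN x : ideal_gen S x -> ideal_gen S (- x).
Proof. by rewrite -mulN1r; apply: ideal_genMl. Qed.
Lemma ideal_genZ c x : ideal_gen S x -> ideal_gen S (c *: x).
Proof. by rewrite -[c *: x]mulr_algl; apply: ideal_genMl. Qed.

Definition ideal_equiv (x y : A) : bool := `[< ideal_gen S (x - y) >].

Fact ideal_equiv_class : equiv_class_of ideal_equiv.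
Proof.
split=> [x|x y|y x z]; rewrite /ideal_equiv.
- by rewrite subrr; apply/asboolP; left.
- by apply/asboolP/asboolP => /ideal_genN; rewrite opprB.
- move=> /asboolP Sxy /asboolP Syz; apply/asboolP.
  by rewrite -[x](subrK y) -addrA; apply: ideal_genD.
Qed.
Canonical ideal_equiv_rel := EquivRelPack ideal_equiv_class.
Canonical ideal_equiv_encModRel := defaultEncModRel ideal_equiv.

Definition quot_alg & ~ ideal_gen S 1 := {eq_quot ideal_equiv}.
Local Notation Q := (quot_alg proper).

HB.instance Definition _ : EqQuotient A ideal_equiv Q := EqQuotient.on Q.
HB.instance Definition _ := Choice.on Q.

Definition quot_pi (x : A) : Q := \pi_Q x.

Lemma quot_piP x y : ideal_gen S (x - y) <-> quot_pi x = quot_pi y.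
Proof.
rewrite /quot_pi; split.
  by move=> Sxy; apply/eqP; rewrite piE; apply/asboolP.
by move/eqP; rewrite piE => /asboolP.
Qed.

Lemma quot_piK (x : Q) : quot_pi (repr x) = x. Proof. exact: reprK. Qed.

Lemma repr_quot_pi x : ideal_gen S (repr (quot_pi x) - x).
Proof. by apply/quot_piP; rewrite quot_piK. Qed.

Definition quot_add (x y : Q) := quot_pi (repr x + repr y).
Definition quot_opp (x : Q) := quot_pi (- repr x).
Definition quot_mul (x y : Q) := quot_pi (repr x * repr y).
Definition quot_scale (c : K) (x : Q) := quot_pi (c *: repr x).

Lemma quot_addE x y : quot_add (quot_pi x) (quot_pi y) = quot_pi (x + y).
Proof.
by apply/quot_piP; rewrite opprD addrACA; apply: ideal_genD; apply: repr_quot_pi.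
Qed.
Lemma quot_oppE x : quot_opp (quot_pi x) = quot_pi (- x).
Proof. by apply/quot_piP; rewrite -opprD; apply/ideal_genN/repr_quot_pi. Qed.
Lemma quot_mulE x y : quot_mul (quot_pi x) (quot_pi y) = quot_pi (x * y).
Proof.
apply/quot_piP; set x' := repr _; set y' := repr _.
have -> : x' * y' - x * y = (x' - x) * y' + x * (y' - y).
  by rewrite mulrBl mulrBr addrA subrK.
by apply: ideal_genD;
  [apply/ideal_genMr/repr_quot_pi | apply/ideal_genMl/repr_quot_pi].
Qed.
Lemma quot_scaleE c x : quot_scale c (quot_pi x) = quot_pi (c *: x).
Proof. by apply/quot_piP; rewrite -scalerBr; apply/ideal_genZ/repr_quot_pi. Qed.

Fact quot_addA : associative quot_add.
Proof.
move=> x y z; rewrite -[x]quot_piK -[y]quot_piK -[z]quot_piK.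
by rewrite !quot_addE addrA.
Qed.
Fact quot_addC : commutative quot_add.
Proof. by move=> x y; rewrite /quot_add addrC. Qed.
Fact quot_add0 : left_id (quot_pi 0) quot_add.
Proof. by move=> x; rewrite -[x]quot_piK quot_addE add0r. Qed.
Fact quot_addN : left_inverse (quot_pi 0) quot_opp quot_add.
Proof. by move=> x; rewrite -[x]quot_piK quot_oppE quot_addE addNr. Qed.
HB.instance Definition _ :=
  GRing.isZmodule.Build Q quot_addA quot_addC quot_add0 quot_addN.

Fact quot_mulA : associative quot_mul.
Proof.
move=> x y z; rewrite -[x]quot_piK -[y]quot_piK -[z]quot_piK.
by rewrite !quot_mulE mulrA.
Qed.
Fact quot_mul1 : left_id (quot_pi 1) quot_mul.
Proof. by move=> x; rewrite -[x]quot_piK quot_mulE mul1r. Qed.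
Fact quot_mulr1 : right_id (quot_pi 1) quot_mul.
Proof. by move=> x; rewrite -[x]quot_piK quot_mulE mulr1. Qed.
Fact quot_mulDl : left_distributive quot_mul quot_add.
Proof.
move=> x y z; rewrite -[x]quot_piK -[y]quot_piK -[z]quot_piK.
by rewrite !(quot_addE, quot_mulE) mulrDl.
Qed.
Fact quot_mulDr : right_distributive quot_mul quot_add.
Proof.
move=> x y z; rewrite -[x]quot_piK -[y]quot_piK -[z]quot_piK.
by rewrite !(quot_addE, quot_mulE) mulrDr.
Qed.
Fact quot_oner_neq0 : quot_pi 1 != quot_pi 0.
Proof. by apply/eqP => /quot_piP; rewrite subr0. Qed.
HB.instance Definition _ := GRing.Zmodule_isNzRing.Build Q
  quot_mulA quot_mul1 quot_mulr1 quot_mulDl quot_mulDr quot_oner_neq0.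

Fact quot_scaleA a b x : quot_scale a (quot_scale b x) = quot_scale (a * b) x.
Proof. by rewrite -[x]quot_piK !quot_scaleE scalerA. Qed.
Fact quot_scale1 : left_id 1 quot_scale.
Proof. by move=> x; rewrite -[x]quot_piK quot_scaleE scale1r. Qed.
Fact quot_scaleDr : right_distributive quot_scale +%R.
Proof.
move=> c x y; rewrite -[x]quot_piK -[y]quot_piK /GRing.add /=.
by rewrite !(quot_addE, quot_scaleE) scalerDr.
Qed.
Fact quot_scaleDl x : {morph quot_scale^~ x : a b / a + b}.
Proof.
move=> a b; rewrite -[x]quot_piK [in RHS]/GRing.add /=.
by rewrite !(quot_addE, quot_scaleE) scalerDl.
Qed.
HB.instance Definition _ := GRing.Zmodule_isLmodule.Build K Q
  quot_scaleA quot_scale1 quot_scaleDr quot_scaleDl.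

Fact quot_scaleAl (c : K) (x y : Q) : c *: (x * y) = (c *: x) * y.
Proof.
rewrite -[x]quot_piK -[y]quot_piK /GRing.mul /GRing.scale /=.
by rewrite !(quot_mulE, quot_scaleE) -scalerAl.
Qed.
HB.instance Definition _ := GRing.Lmodule_isLalgebra.Build K Q quot_scaleAl.

Fact quot_scaleAr (c : K) (x y : Q) : c *: (x * y) = x * (c *: y).
Proof.
rewrite -[x]quot_piK -[y]quot_piK /GRing.mul /GRing.scale /=.
by rewrite !(quot_mulE, quot_scaleE) -scalerAr.
Qed.
HB.instance Definition _ := GRing.Lalgebra_isAlgebra.Build K Q quot_scaleAr.

Fact quot_pi_is_zmod_morphism : zmod_morphism quot_pi.
Proof. by move=> x y; rewrite -quot_addE -quot_oppE. Qed.
Fact quot_pi_is_monoid_morphism : monoid_morphism quot_pi.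
Proof. by split=> // x y; rewrite -quot_mulE. Qed.
Fact quot_pi_is_scalable : scalable quot_pi.
Proof. by move=> c x; rewrite -quot_scaleE. Qed.
HB.instance Definition _ :=
  GRing.isZmodMorphism.Build A Q quot_pi quot_pi_is_zmod_morphism.
HB.instance Definition _ :=
  GRing.isMonoidMorphism.Build A Q quot_pi quot_pi_is_monoid_morphism.
HB.instance Definition _ :=
  GRing.isScalable.Build K A Q *:%R quot_pi quot_pi_is_scalable.

End Quotient.
End TwoSidedIdeal.

Section FreeAlgebra.
Variables (K : fieldType) (I : choiceType).

Definition free_alg : Type := {malg K[{fmonom I}]}.
HB.instance Definition _ := GRing.Lalgebra.on free_alg.

Fact malg_scaleAr (c : K) (x y : {malg K[{fmonom I}]}) :
  c *: (x * y) = x * (c *: y).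
Proof.
apply/malgP => k; rewrite mcoeffZ mcoeffMl.
rewrite (mcoeffMlw _ (finmap.fsubset_refl _) (msuppZ_le c y)).
rewrite mulr_sumr; apply: eq_bigr => i _; rewrite mulr_sumr.
by apply: eq_bigr => j _; rewrite mcoeffZ mulrnAr mulrCA.
Qed.

Fact free_alg_scaleAr (c : K) (x y : free_alg) : c *: (x * y) = x * (c *: y).
Proof. exact: malg_scaleAr. Qed.
HB.instance Definition _ :=
  GRing.Lalgebra_isAlgebra.Build K free_alg free_alg_scaleAr.

Definition free_gen (g : I) : free_alg := @mkmalgU {fmonom I} K (fmu g) 1.

Definition free_aug (x : free_alg) : K := @mcoeff {fmonom I} K mone x.
HB.instance Definition _ := GRing.RMorphism.copy free_aug (@mcoeff {fmonom I} K mone).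

Lemma free_aug_gen g : free_aug (free_gen g) = 0.
Proof. by rewrite /free_aug /free_gen mcoeffU1 fm1_eq1. Qed.

Lemma free_aug_const (c : K) : free_aug c%:A = c.
Proof. by rewrite /free_aug mcoeffZ mcoeff1 eqxx mulr1. Qed.

End FreeAlgebra.

Section Operators.
Variable N : nat.

(* 'M[A]_#|{: mindex n}| is the algebra of operators on the n-th tensor power of V,
   with coefficients in A, in the basis x_{s 0} (x) ... (x) x_{s n.-1}; rows are
   lower indices and columns upper ones, so that *m is (AB)_i^j = A_i^k B_k^j.
   An operator on V (x) V by itself is a matrix X : 'M_(N * N) with
   X_{ij}^{ks} = X (mxvec_index i j) (mxvec_index k s). *)
Local Notation mindex n := {ffun 'I_n -> 'I_N}.

Definition entry2 (A : Type) (X : 'M[A]_(N * N)) (i j k s : 'I_N) : A :=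
  X (mxvec_index i j) (mxvec_index k s).

Section Act.
Variables (A : nzRingType) (n : nat).

Definition act1 (p : 'I_n) (X : 'M[A]_N) : 'M[A]_#|{: mindex n}| :=
  \matrix_(a, b) let s : mindex n := enum_val a in
    let t : mindex n := enum_val b in
    X (s p) (t p) *+ [forall r, (r != p) ==> (s r == t r)].

Definition act2 (p p' : 'I_n) (X : 'M[A]_(N * N)) : 'M[A]_#|{: mindex n}| :=
  \matrix_(a, b) let s : mindex n := enum_val a in
    let t : mindex n := enum_val b in
    entry2 X (s p) (s p') (t p) (t p')
      *+ [forall r, (r != p) && (r != p') ==> (s r == t r)].

End Act.

(* X_k, acting in the factors k and k+1, numbered from 1 as in X_1 = X_12, of
   the n.+1 factors. It is only meant for 1 <= k <= n. *)
Definition act_at (A : nzRingType) (n k : nat) (X : 'M[A]_(N * N)) :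
  'M[A]_#|{: mindex n.+1}| := act2 (inord k.-1) (inord k) X.

Variable K : fieldType.

(* Scalar matrices viewed over a K-algebra A. *)
Definition liftmx (A : algType K) (m n : nat) (X : 'M[K]_(m, n)) : 'M[A]_(m, n) :=
  map_mx (fun c => c%:A) X.

Section HeckeSymmetry.
Variables (q : K) (R Psi : 'M[K]_(N * N)).

Definition qint (k : nat) : K := (q ^+ k - q ^- k) / (q - q^-1).

Definition braid_relation : Prop :=
  act_at 2 1 R *m act_at 2 2 R *m act_at 2 1 R =
  act_at 2 2 R *m act_at 2 1 R *m act_at 2 2 R.

Definition hecke_symmetry : Prop :=
  braid_relation /\ (q%:M - R) *m (q^-1%:M + R) = 0.

Definition skew_inverse : Prop :=
  forall i k p q' : 'I_N,
    \sum_(j < N) \sum_(l < N) entry2 R i j k l * entry2 Psi l p j q' =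
    ((i == q') && (p == k))%:R.

(* C_i^j = Psi_{ik}^{jk}. *)
Definition Cmx : 'M[K]_N := \matrix_(i, j) \sum_(k < N) entry2 Psi i k j k.

(* The operator P^(k) on n.+1 factors, for 1 <= k <= n.+1; the value at k = 0
   is irrelevant. *)
Fixpoint skew_symmetrizer (n k : nat) : 'M[K]_#|{: mindex n.+1}| :=
  if k is k'.+1 then
    if k' == 0%N then 1%:M else
      let P := skew_symmetrizer n k' in
      (qint k' / qint k'.+1) *:
        (P *m ((q ^+ k' / qint k')%:M - act_at n k' R) *m P)
  else 1%:M.

End HeckeSymmetry.

(* Tr_{R(1...n)} X = Tr_{(1...n)} (X C_1 ... C_n), and Tr_{R(2...n.+1)}. *)
Section RTrace.
Variables (Psi : 'M[K]_(N * N)) (A : algType K).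
Let C := Cmx Psi.

Definition Rtrace (n : nat) (X : 'M[A]_#|{: mindex n}|) : A :=
  \sum_(s : mindex n) \sum_(t : mindex n)
    (\prod_(r < n) C (t r) (s r)) *: X (enum_rank s) (enum_rank t).

Definition Rtrace_tail (n : nat) (X : 'M[A]_#|{: mindex n.+1}|) : 'M[A]_N :=
  \matrix_(i, j)
    \sum_(s : mindex n.+1 | s ord0 == i) \sum_(t : mindex n.+1 | t ord0 == j)
      (\prod_(r < n.+1 | r != ord0) C (t r) (s r)) *:
        X (enum_rank s) (enum_rank t).

End RTrace.

Section Yangian.
Variables (q : K) (R : 'M[K]_(N * N)).

(* LHS - RHS of R(u,v) L_1(u) R L_1(v) = L_1(v) R L_1(u) R(u,v) after
   multiplication by (u - v) u^(-1) v^(-1), which clears the denominator of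
   R(u,v) = R - u (q - q^(-1)) / (u - v) I:
   (u - v) u^(-1) v^(-1) R(u,v) = (v^(-1) - u^(-1)) R - (q - q^(-1)) v^(-1) I.
   The outer series variable is u and the inner one is v. *)
Definition yang_defect (A : algType K) (L : 'M[fps A]_N) :
    'M[fps (fps A)]_#|{: mindex 2}| :=
  let uV := fps_uinv (fps A) in
  let vV := fps_const (fps_uinv A) in
  let R1 := liftmx (fps (fps A)) (act_at 1 1 R) in
  let Lu := act1 ord0 (map_mx (fps_map (@fps_const A)) L) in
  let Lv := act1 ord0 (map_mx (@fps_const (fps A)) L) in
  let Ruv := (vV - uV) *: R1 - ((q - q^-1) *: vV)%:M in
  Ruv *m Lu *m R1 *m Lv - Lv *m R1 *m Lu *m Ruv.

(* The generator (k, i, j) is l_i^j[k.+1]. *)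
Definition yangian_free : algType K := free_alg K (nat * 'I_N * 'I_N)%type.

Definition generating_mx (A : algType K) (l : nat -> 'I_N -> 'I_N -> A) :
    'M[fps A]_N :=
  \matrix_(i, j) Fps (fun k => if k is k'.+1 then l k' i j else (i == j)%:R).

Definition yangian_rel (x : yangian_free) : Prop :=
  let L := generating_mx (fun k i j => free_gen K (k, i, j)) in
  exists a b r s, x = fcoef (fcoef (yang_defect L a b) r) s.

Lemma map_liftmx (A B : algType K) (f : {rmorphism A -> B}) :
  (forall c, f c%:A = c%:A) ->
  forall m n (X : 'M_(m, n)), map_mx f (liftmx A X) = liftmx B X.
Proof. by move=> fA m n X; apply/matrixP => i j; rewrite !mxE fA. Qed.

Lemma map_act1 (A B : nzRingType) (f : {rmorphism A -> B}) n (p : 'I_n) X :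
  map_mx f (act1 p X) = act1 p (map_mx f X).
Proof. by apply/matrixP => i j; rewrite !mxE /= rmorphMn mxE. Qed.

Lemma act1_1 (A : nzRingType) n (p : 'I_n) : act1 p (1%:M : 'M[A]_N) = 1%:M.
Proof.
apply/matrixP => a b; rewrite !mxE /= mxE -mulrnA mulnb; congr (_%:R).
rewrite -(inj_eq (@enum_val_inj _ _)); congr nat_of_bool; apply/andP/eqP.
  case=> /eqP sp /forallP st; apply/ffunP => r.
  by have [->//|rp] := eqVneq r p; apply/eqP/(implyP (st r)).
by move=> ->; split=> //; apply/forallP => r; apply/implyP.
Qed.

Lemma fps_map_alg (A B : algType K) (f : {rmorphism A -> B}) :
  (forall c, f c%:A = c%:A) -> forall c, fps_map f c%:A = c%:A.
Proof.
move=> fA c; apply: fpsP => k.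
rewrite -[LHS]/(f (fcoef c%:A k)) !fcoefZ !fcoef1.
by case: (k == 0%N); rewrite ?fA // !scaler0 rmorph0.
Qed.

Lemma yang_defect_map (A B : algType K) (f : {rmorphism A -> B}) L :
  (forall c, f c%:A = c%:A) ->
  map_mx (fps_map (fps_map f)) (yang_defect L) =
  yang_defect (map_mx (fps_map f) L).
Proof.
move=> fA; pose F : {rmorphism fps (fps A) -> fps (fps B)} := fps_map (fps_map f).
rewrite -[LHS]/(map_mx F (yang_defect L)).
have FA c : F c%:A = c%:A := fps_map_alg (fps_map_alg fA) c.
have eu : map_mx F (map_mx (fps_map (@fps_const A)) L) =
    map_mx (fps_map (@fps_const B)) (map_mx (fps_map f) L).
  rewrite -!map_mx_comp; apply: eq_map_mx => x; apply: fpsP => k /=.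
  exact: fps_map_const.
have ev : map_mx F (map_mx (@fps_const (fps A)) L) =
    map_mx (@fps_const (fps B)) (map_mx (fps_map f) L).
  by rewrite -!map_mx_comp; apply: eq_map_mx => x /=; rewrite fps_map_const.
have Fu : F (fps_uinv (fps A)) = fps_uinv (fps B) by exact: fps_map_uinv.
have Fv : F (fps_const (fps_uinv A)) = fps_const (fps_uinv B).
  transitivity (fps_const (fps_map f (fps_uinv A))); first exact: fps_map_const.
  by rewrite fps_map_uinv.
have FZ c x : F (c *: x) = c *: F x.
  by rewrite -mulr_algl rmorphM FA mulr_algl.
have FM (X Y Z W : 'M_#|{: mindex 2}|) :
    map_mx F (X *m Y *m Z *m W - W *m Z *m Y *m X) =
    map_mx F X *m map_mx F Y *m map_mx F Z *m map_mx F W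
    - map_mx F W *m map_mx F Z *m map_mx F Y *m map_mx F X.
  by rewrite map_mxB !map_mxM.
have FR a b (X : 'M_#|{: mindex 2}|) :
    map_mx F (a *: X - b%:M) = F a *: map_mx F X - (F b)%:M.
  by rewrite map_mxB map_mxZ map_scalar_mx.
rewrite /yang_defect [LHS]FM FR.
rewrite !(map_act1 F) eu ev (map_liftmx FA).
by rewrite FZ rmorphB Fu Fv.
Qed.

Lemma yang_defect1 (A : algType K) : yang_defect (1%:M : 'M[fps A]_N) = 0.
Proof.
rewrite /yang_defect; set R1 := liftmx _ _.
have -> : map_mx (fps_map (@fps_const A)) 1%:M = 1%:M :> 'M_N.
  apply/matrixP => i j; rewrite !mxE; apply: fpsP => k /=.
  case: (i == j); rewrite ?fcoef1 ?fcoef0 /=.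
    by case: (k == 0%N) => //; apply: fpsP => l; rewrite /= if_same.
  by apply: fpsP => l; rewrite /= if_same.
have -> : map_mx (@fps_const (fps A)) 1%:M = 1%:M :> 'M_N.
  apply/matrixP => i j; rewrite !mxE; apply: fpsP => k /=.
  by case: (i == j) => //=; rewrite if_same.
have comm (a : fps (fps A)) X : R1 *m (a *: X) = a *: (R1 *m X).
  apply/matrixP => i j; rewrite !mxE mulr_sumr; apply: eq_bigr => k _.
  by rewrite !mxE !mulr_algl scalerAr.
have unit1 (Q S : 'M[fps (fps A)]_#|{: mindex 2}|) :
    Q *m 1%:M *m S *m 1%:M - 1%:M *m S *m 1%:M *m Q = Q *m S - S *m Q.
  by rewrite !mulmx1 mul1mx.
rewrite !act1_1 unit1; apply/eqP; rewrite subr_eq0; apply/eqP.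
rewrite mulmxBl mulmxBr comm -scalemxAl -scalemx1 comm -scalemxAl.
by rewrite (mul1mx R1) (mulmx1 R1).
Qed.

Fact yangian_proper : ~ ideal_gen yangian_rel 1.
Proof.
pose f : {rmorphism yangian_free -> K^o} := @free_aug K (nat * 'I_N * 'I_N)%type.
suff f0 x : ideal_gen yangian_rel x -> f x = 0.
  by move/f0/eqP; rewrite rmorph1 oner_eq0.
elim=> [|c s d y rel_s _ IH]; first by rewrite rmorph0.
rewrite rmorphD !rmorphM IH addr0.
suff -> : f s = 0 by rewrite mulr0 mul0r.
case: rel_s => a [b [r [t ->]]]; set L := generating_mx _.
have fA c' : f c'%:A = c'%:A.
  by rewrite [LHS]free_aug_const /GRing.scale /= mulr1.
have fL : map_mx (fps_map f) L = 1%:M.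
  apply/matrixP => i j; rewrite !mxE; apply: fpsP => -[|k] /=.
    by rewrite rmorph_nat; case: (i == j).
  by rewrite [LHS]free_aug_gen; case: (i == j).
have := yang_defect_map L fA; rewrite fL yang_defect1 => /matrixP/(_ a b).
by rewrite !mxE => /(congr1 (fun x => fcoef (fcoef x r) t)).
Qed.

Definition yangian : Type := quot_alg yangian_proper.
HB.instance Definition _ := GRing.Algebra.on yangian.

Definition yangian_gen (k : nat) (i j : 'I_N) : yangian :=
  quot_pi yangian_proper (free_gen K (k, i, j)).

Definition yangian_mx : 'M[fps yangian]_N := generating_mx yangian_gen.

Lemma yangian_mxP : yang_defect yangian_mx = 0.
Proof.
pose f : {rmorphism yangian_free -> yangian} := quot_pi yangian_proper.
have fA c : f c%:A = c%:A.
  by rewrite /f /= linearZ /= rmorph1.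
pose L := generating_mx (fun k i j => free_gen K (k, i, j) : yangian_free).
have -> : yangian_mx = map_mx (fps_map f) L.
  apply/matrixP => i j; rewrite !mxE; apply: fpsP => -[|k] //=.
  by rewrite rmorph_nat.
rewrite -yang_defect_map //; apply/matrixP => a b; rewrite [LHS]mxE [RHS]mxE.
apply: fpsP => r; apply: fpsP => s /=; rewrite -(rmorph0 f).
apply/quot_piP; rewrite subr0.
have : yangian_rel (fcoef (fcoef (yang_defect L a b) r) s) by exists a, b, r, s.
by move/(IdealMD 1 1)/(_ (Ideal0 _)); rewrite mul1r mulr1 addr0.
Qed.

End Yangian.

Section SymmetricFunctions.
Variables (q : K) (R Psi : 'M[K]_(N * N)) (A : algType K).

Definition dilate_mx (c : K) (L : 'M[fps A]_N) : 'M[fps A]_N :=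
  map_mx (fps_dilate c) L.

(* L_{\overline k} on n.+1 factors, for 1 <= k <= n.+1; the value at k = 0 is
   irrelevant. *)
Fixpoint Lbar (n k : nat) (L : 'M[fps A]_N) : 'M[fps A]_#|{: mindex n.+1}| :=
  if k is k'.+1 then
    if k' == 0%N then act1 ord0 L else
      liftmx (fps A) (act_at n k' R) *m Lbar n k' L
        *m liftmx (fps A) (act_at n k' (invmx R))
  else 1%:M.

(* P^(k) L_{\overline 1}(u) ... L_{\overline k}(q^(-2(k-1)) u) for k = n.+1. *)
Definition skew_product (n : nat) (L : 'M[fps A]_N) :
    'M[fps A]_#|{: mindex n.+1}| :=
  liftmx (fps A) (skew_symmetrizer q R n n.+1) *m
    \prod_(1 <= j < n.+2) Lbar n j (dilate_mx (q ^- (2 * (j - 1))) L).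

Definition elem_sym (L : 'M[fps A]_N) (k : nat) : fps A :=
  if k is n.+1 then Rtrace Psi (skew_product n L) else 1.

(* L^{\wedge k} for k >= 1. *)
Definition skew_power (L : 'M[fps A]_N) (k : nat) : 'M[fps A]_N :=
  if k is n.+1 then
    if n == 0%N then L else Rtrace_tail Psi (skew_product n L)
  else 1%:M.

(* L^{[k]} for k >= 1. *)
Definition matrix_power (L : 'M[fps A]_N) (k : nat) : 'M[fps A]_N :=
  if k is n.+1 then
    Rtrace_tail Psi
      ((\prod_(1 <= j < n.+2) Lbar n j (dilate_mx (q ^- (2 * (k - j))) L)) *m
       \prod_(1 <= j < n.+1) liftmx (fps A) (act_at n (n.+1 - j) R))
  else 1%:M.

End SymmetricFunctions.
End Operators.

Arguments yangian_mx {N K} q R.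

(* Main.v *)
From HB Require Import structures.
Require Import Defs.
From mathcomp Require Import all_boot all_order all_algebra.
From mathcomp Require Import ring.

(* The recursion
     k_q L^{/\k} = L(q^{-2(k-1)}u) (q^{k-1} e_{k-1} I - (k-1)_q L^{/\(k-1)})
   gives the identities by induction on k, since L^{[k]} is the ordered product
   L(q^{-2(k-1)}u) ... L(u).  To prove it, put w = R_1 ... R_{k-1} and let
     D_k = L_{\bar 1}(q^{-2(k-1)}u) ... L_{\bar k}(u)
   be the product with the arguments in decreasing order.
   - The Yangian relations at v = q^{-2m}u and the factorization of P^{(k)} into
     factors q^m/m_q - R_m show that P^{(k)} intertwines the increasing product with
     D_k, so L^{/\k} and e_k are R-traces of D_k P^{(k)}.
   - Expanding P^{(k)} over coset representatives,
       k_q P^{(k)} = w P^{(k-1)} w^{-1} \sum_j (-1)^j q^{k-1-j} R_1 ... R_j,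
     and D_k w = L_1(q^{-2(k-1)}u) w D_{k-1}, one is left with the R-traces over
     the factors 2, ..., k of w Z R_{k-1}^{-1} ... R_{j+1}^{-1}, where
     Z = D_{k-1} P^{(k-1)} is fixed up to the factor -q^{-1} by R_1, ..., R_{k-2}.
   - By Tr_{R(2)} R_1 = I and Tr_{R(2)} (R_1 X_1 R_1^{-1}) = Tr_R(X) I, the trace is
     e_{k-1} I for j = 0 and (-q^{-1})^{j-1} L^{/\(k-1)} for j > 0. *)

Set Implicit Arguments.
Unset Strict Implicit.
Unset Printing Implicit Defensive.

Import GRing.Theory.
Local Open Scope ring_scope.

(** * Formal power series *)

(** With an indicator of i + j = n on a full square, the summation ranges no longer depend on n, so
    that nested convolutions can be exchanged freely. *)
Lemma fps_sum_antidiag (V : nmodType) (f : nat -> nat -> V) (n m : nat) :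
  (n <= m)%N ->
  \sum_(i < n.+1) f i (n - i)%N =
  \sum_(i < m.+1) \sum_(j < m.+1) f i j *+ (i + j == n)%N.
Proof.
move=> nm; rewrite (big_ord_widen_cond m.+1 xpredT (fun i => f i (n - i)%N)) //.
rewrite big_mkcond; apply: eq_bigr => i _ /=; rewrite ltnS.
case: (leqP i n) => [lin|lni].
  have lt : (n - i < m.+1)%N by rewrite ltnS (leq_trans (leq_subr _ _)).
  rewrite (bigD1 (Ordinal lt)) //= subnKC // eqxx mulr1n big1 ?addr0 // => j.
  rewrite -val_eqE /= => ne; rewrite -(subnKC lin) eqn_add2l (negbTE ne).
  by rewrite mulr0n.
rewrite big1 // => j _; rewrite eqn_leq leqNgt.
by rewrite (leq_trans lni (leq_addr _ _)) mulr0n.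
Qed.

Section Diagonal.
Variables (K : fieldType) (A : algType K).

(** The substitution v = u in a series whose outer variable is u and whose inner variable is v. *)
Definition fps_diag (F : fps (fps A)) : fps A :=
  Fps (fun m => \sum_(i < m.+1) fcoef (fcoef F i) (m - i)%N).

Lemma fps_diag_is_zmod_morphism : zmod_morphism fps_diag.
Proof.
move=> F G; apply: fpsP => m; rewrite /= -sumrN -big_split /=.
by apply: eq_bigr => i _.
Qed.

(** Both sides are the sum of F_{lr} G_{tw} over l + r + t + w = m; the left groups the indices as
    (l + t) + (r + w), the right as (l + r) + (t + w). *)
Lemma fps_diagM : {morph fps_diag : F G / F * G}.
Proof.
move=> F G; apply: fpsP => m.
pose T (l r t w : 'I_m.+1) := fcoef (fcoef F l) r * fcoef (fcoef G t) w.
have exch (P : 'I_m.+1 -> 'I_m.+1 -> 'I_m.+1 -> A) :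
    \sum_(i < m.+1) \sum_(j < m.+1) \sum_l P i j l =
    \sum_l \sum_(i < m.+1) \sum_(j < m.+1) P i j l.
  rewrite [RHS]exchange_big /=; apply: eq_bigr => i _.
  by rewrite [RHS]exchange_big.
(* Sums out the intermediate degrees i and j; if x + y = m, then x and y both lie in the summation
   range. *)
have collapse (x y : nat) (a : A) :
    \sum_(i < m.+1) \sum_(j < m.+1) a *+ (y == j) *+ (x == i) *+ (i + j == m)%N =
    a *+ (x + y == m)%N.
  have [e|ne] := eqVneq (x + y)%N m; last first.
    rewrite big1 // => i _; rewrite big1 // => j _; rewrite -!mulrnA !mulnb.
    by case: eqP => //= <-; case: eqP => //= <-; rewrite (negbTE ne).
  have ly : (y < m.+1)%N by rewrite ltnS -e leq_addl.
  have lx : (x < m.+1)%N by rewrite ltnS -e leq_addr.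
  rewrite (bigD1 (Ordinal lx)) //= (bigD1 (Ordinal ly)) //= !eqxx e eqxx.
  rewrite big1 ?addr0 => [|i]; last first.
    by rewrite -val_eqE eq_sym /= => /negbTE ->; rewrite mulr0n !mul0rn.
  rewrite big1 ?addr0 // => j.
  rewrite -val_eqE eq_sym /= => /negbTE ->; rewrite big1 // => i _.
  by rewrite mulr0n !mul0rn.
transitivity (\sum_l \sum_t \sum_r \sum_w T l r t w *+ (l + t + (r + w) == m)%N).
  transitivity (\sum_(i < m.+1) \sum_(j < m.+1) \sum_l \sum_t \sum_r \sum_w
      T l r t w *+ (r + w == j)%N *+ (l + t == i)%N *+ (i + j == m)%N).
    rewrite [LHS](fps_sum_antidiag (fun i j => fcoef (fcoef (F * G) i) j) (leqnn m)).
    apply: eq_bigr => i _; apply: eq_bigr => j _.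
    rewrite fcoefM fcoef_sum.
    rewrite (fps_sum_antidiag (fun l t => fcoef (fcoef F l * fcoef G t) j)
       (leq_ord i)) -sumrMnl; apply: eq_bigr => l _.
    rewrite -sumrMnl; apply: eq_bigr => t _.
    rewrite fcoefM (fps_sum_antidiag (fun r w => fcoef (fcoef F l) r *
       fcoef (fcoef G t) w) (leq_ord j)) -!sumrMnl; apply: eq_bigr => r _.
    by rewrite -!sumrMnl.
  do 4![rewrite exch; apply: eq_bigr => ? _].
  exact: collapse.
transitivity (\sum_(i < m.+1) \sum_(j < m.+1) \sum_l \sum_r \sum_t \sum_w
    T l r t w *+ (t + w == j)%N *+ (l + r == i)%N *+ (i + j == m)%N); last first.
  rewrite fcoefM [RHS](fps_sum_antidiag (fun i j => fcoef (fps_diag F) i *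
    fcoef (fps_diag G) j) (leqnn m)).
  apply: eq_bigr => i _; apply: eq_bigr => j _ /=.
  rewrite (fps_sum_antidiag (fun l r => fcoef (fcoef F l) r) (leq_ord i)).
  rewrite (fps_sum_antidiag (fun l r => fcoef (fcoef G l) r) (leq_ord j)).
  rewrite mulr_suml -sumrMnl; apply: eq_bigr => l _.
  rewrite mulr_suml -sumrMnl; apply: eq_bigr => r _.
  rewrite mulr_sumr -!sumrMnl; apply: eq_bigr => t _.
  rewrite mulr_sumr -!sumrMnl; apply: eq_bigr => w _.
  by rewrite mulrnAl mulrnAr.
symmetry; rewrite exch; apply: eq_bigr => l _.
rewrite exch [RHS]exchange_big; apply: eq_bigr => r _ /=.
do 2![rewrite exch; apply: eq_bigr => ? _].
by rewrite collapse addnACA.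
Qed.

Lemma fps_diag1 : fps_diag 1 = 1.
Proof.
apply: fpsP => m.
transitivity (\sum_(i < m.+1) fcoef (fcoef (1 : fps (fps A)) i) (m - i)); first by [].
rewrite big_ord_recl subn0 big1 ?addr0 // => i _.
Qed.

HB.instance Definition _ := GRing.isZmodMorphism.Build (fps (fps A)) (fps A)
  fps_diag fps_diag_is_zmod_morphism.
HB.instance Definition _ := GRing.isMonoidMorphism.Build (fps (fps A)) (fps A)
  fps_diag (conj fps_diag1 fps_diagM).

Variable c : K.

Lemma fps_dilate_is_zmod_morphism : zmod_morphism (@fps_dilate K A c).
Proof. by move=> f g; apply: fpsP => k /=; rewrite scalerBr. Qed.

Lemma fps_dilate_is_monoid_morphism : monoid_morphism (@fps_dilate K A c).
Proof.
split=> [|f g]; apply: fpsP => k /=.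
  by case: eqP => [->|_]; rewrite ?expr0 ?invr1 ?scale1r ?scaler0.
rewrite !fcoefM scaler_sumr; apply: eq_bigr => i _ /=.
by rewrite -scalerAl -scalerAr scalerA -invfM -exprD addnC subnK ?leq_ord.
Qed.

HB.instance Definition _ := GRing.isZmodMorphism.Build (fps A) (fps A)
  (@fps_dilate K A c) fps_dilate_is_zmod_morphism.
HB.instance Definition _ := GRing.isMonoidMorphism.Build (fps A) (fps A)
  (@fps_dilate K A c) fps_dilate_is_monoid_morphism.

Lemma fps_dilate_alg (y : K) : fps_dilate c y%:A = y%:A :> fps A.
Proof.
apply: fpsP => k /=.
by case: eqP => [->|_]; rewrite ?scaler0 // expr0 invr1 scale1r.
Qed.

End Diagonal.

(** * Specialization of the Yangian relations at v = c u *)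

Section Specialization.
Variables (N : nat) (K : fieldType) (A : algType K) (q : K) (R : 'M[K]_(N * N)).
Local Notation mindex n := {ffun 'I_n -> 'I_N}.

Lemma fps_uinv_central (f : fps A) : f * fps_uinv A = fps_uinv A * f.
Proof.
apply: fpsP => k; rewrite !fcoefM (reindex_inj rev_ord_inj) /=.
apply: eq_bigr => i _; rewrite subSS subKn ?leq_ord //.
by case: (nat_of_ord i == 1%N); rewrite ?(mulr1, mul1r, mulr0, mul0r).
Qed.

(** Multiplication by u^(-1) shifts the coefficients by one place. This removes the factor left over
    from clearing denominators in [yang_defect]. *)
Lemma fps_uinv_injl (f : fps A) : fps_uinv A * f = 0 -> f = 0.
Proof.
move=> e; apply: fpsP => k; have := congr1 (fun g => fcoef g k.+1) e.
rewrite /= fcoefM big_ord_recl mul0r add0r big_ord_recl /= subn1 mul1r.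
by rewrite big1 ?addr0 // => i _; rewrite mul0r.
Qed.

(** At v = c u the operator (v^(-1) - u^(-1)) R - (q - q^(-1)) v^(-1) I becomes u^(-1) X, and the
    central factor u^(-1) cancels. *)
Lemma yang_defect_specialize (L : 'M[fps A]_N) (c : K) :
  yang_defect q R L = 0 ->
  let R1 := act_at 1 1 R in
  let L1 := act1 (ord0 : 'I_2) L in
  let Lc := act1 (ord0 : 'I_2) (dilate_mx c L) in
  let X := liftmx (fps A) ((c^-1 - 1) *: R1 - ((q - q^-1) / c)%:M) in
  X *m L1 *m liftmx (fps A) R1 *m Lc = Lc *m liftmx (fps A) R1 *m L1 *m X.
Proof.
move=> e R1 L1 Lc X.
(* Dilating the inner series by c and then restricting to the diagonal is the substitution v = c
   u. *)
pose F : {rmorphism fps (fps A) -> fps A} :=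
  @fps_diag K A \o fps_map (@fps_dilate K A c).
have FA x : F x%:A = x%:A.
  rewrite /= (fps_map_alg (@fps_dilate_alg K A c)); apply: fpsP => k /=.
  rewrite big_ord_recl subn0 /= big1 ?addr0 // => i _.
  by rewrite scaler0.
have diag_const (g : fps A) : fps_diag (fps_const g) = g.
  apply: fpsP => k /=; rewrite big_ord_recl subn0 /= big1 ?addr0 // => i _.
have Fc (g : fps A) : F (fps_const g) = fps_dilate c g.
  by rewrite /= fps_map_const diag_const.
have Fm (f : fps A) : F (fps_map (@fps_const A) f) = f.
  apply: fpsP => k; rewrite /= big_ord_recr /= subnn /= expr0 invr1 scale1r.
  rewrite big1 ?add0r // => i _.
  by rewrite subn_eq0 leqNgt ltn_ord /= scaler0.
have Fu : F (fps_uinv (fps A)) = fps_uinv A.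
  rewrite /= fps_map_uinv; apply: fpsP => -[|k] /=; rewrite big_ord_recl ?big_ord0.
    by rewrite addr0.
  by rewrite add0r big_ord_recl subn1 big1 ?addr0 //; case: k.
have Fv : F (fps_const (fps_uinv A)) = c^-1 *: fps_uinv A.
  rewrite Fc; apply: fpsP => k /=.
  by case: eqP => [->|_]; rewrite ?scaler0 // expr1.
have FZ x f : F (x *: f) = x *: F f.
  by rewrite -mulr_algl rmorphM FA mulr_algl.
have := congr1 (map_mx F) e; rewrite map_mx0 /yang_defect map_mxB !map_mxM.
rewrite map_mxB map_mxZ map_scalar_mx rmorphB Fu FZ Fv.
have -> : map_mx F (act1 ord0 (map_mx (fps_map (@fps_const A)) L)) = L1.
  by rewrite (map_act1 F); congr act1; apply/matrixP => i j; rewrite !mxE Fm.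
have -> : map_mx F (act1 ord0 (map_mx (@fps_const (fps A)) L)) = Lc.
  by rewrite (map_act1 F); congr act1; apply/matrixP => i j; rewrite !mxE Fc.
rewrite (map_liftmx FA) -/R1.
have -> : (c^-1 *: fps_uinv A - fps_uinv A) *: liftmx (fps A) R1
    - ((q - q^-1) *: (c^-1 *: fps_uinv A))%:M = fps_uinv A *: X.
  apply/matrixP => i j; rewrite !mxE.
  rewrite -[X in (_ - X) * _]scale1r -scalerBl -scalerAl !scalerA.
  rewrite !mulr_algr /= [RHS]scalerBl -!scalerMnl; congr (_ - _).
  by rewrite -[RHS]scalerA -scalerMnl.
have comm (Y : 'M[fps A]_#|{: mindex 2}|) :
    Y *m (fps_uinv A *: X) = fps_uinv A *: (Y *m X).
  apply/matrixP => a b; rewrite !mxE mulr_sumr; apply: eq_bigr => k _.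
  by rewrite !mxE mulrA fps_uinv_central mulrA.
rewrite comm -!scalemxAl -scalerBr => /matrixP u0; apply/eqP; rewrite -subr_eq0.
apply/eqP/matrixP => a b; have := u0 a b; rewrite [in RHS]mxE mxE.
by move/fps_uinv_injl=> ->; rewrite mxE.
Qed.

End Specialization.

(** * Tensor powers and partial R-traces *)

Section MultiIndex.
Variable N : nat.
Local Notation mindex n := {ffun 'I_n -> 'I_N}.

(** Multi-indices are split at the last factor, because operators are embedded by adding a factor at
    the end and traced out from the end. *)
Definition snoc n (s : mindex n) (i : 'I_N) : mindex n.+1 :=
  [ffun r => if unlift ord_max r is Some r' then s r' else i].

Definition belast_ffun n (s : mindex n.+1) : mindex n :=
  [ffun r => s (lift ord_max r)].

Lemma snoc_max n (s : mindex n) i : snoc s i ord_max = i.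
Proof. by rewrite ffunE unlift_none. Qed.

Lemma snoc_lift n (s : mindex n) i r : snoc s i (lift ord_max r) = s r.
Proof. by rewrite ffunE liftK. Qed.

Lemma snoc_belast n (s : mindex n.+1) : snoc (belast_ffun s) (s ord_max) = s.
Proof.
by apply/ffunP => r; case: (unliftP ord_max r) => [r'|] ->;
  rewrite ?snoc_max // snoc_lift ffunE.
Qed.

Lemma belast_snoc n (s : mindex n) i : belast_ffun (snoc s i) = s.
Proof. by apply/ffunP => r; rewrite ffunE snoc_lift. Qed.

Lemma eq_snoc n (s t : mindex n) i j :
  (snoc s i == snoc t j) = (s == t) && (i == j).
Proof.
apply/eqP/andP => [e|[/eqP -> /eqP ->] //].
by rewrite -(belast_snoc s i) e belast_snoc -(snoc_max s i) e snoc_max.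
Qed.

Lemma sum_snoc (V : nmodType) n (F : mindex n.+1 -> V) :
  \sum_s F s = \sum_s \sum_i F (snoc s i).
Proof.
rewrite pair_big /= (reindex (fun p => snoc p.1 p.2)) //=.
exists (fun s => (belast_ffun s, s ord_max)) => [[s i]|s] _ /=.
  by rewrite belast_snoc snoc_max.
by rewrite snoc_belast.
Qed.

Lemma forall_snoc n (s t : mindex n) i j (P : pred 'I_n.+1) :
  [forall r, P r ==> (snoc s i r == snoc t j r)] =
  [forall r, P (lift ord_max r) ==> (s r == t r)] && (P ord_max ==> (i == j)).
Proof.
apply/forallP/andP => [st|[/forallP st ij] r].
  split; last by have := st ord_max; rewrite !snoc_max.
  by apply/forallP => r; have := st (lift ord_max r); rewrite !snoc_lift.
by case: (unliftP ord_max r) => [r'|] ->; rewrite ?snoc_max // !snoc_lift.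
Qed.

Lemma mindex0_eq (s t : mindex 0) : s = t.
Proof. by apply/ffunP => -[]. Qed.

Lemma inord_lift n k : (k < n.+1)%N ->
  inord k = lift ord_max (inord k : 'I_n.+1) :> 'I_n.+2.
Proof.
move=> kn; apply: val_inj; rewrite [RHS]lift_max !inordK //.
by rewrite [LHS]inordK // leqW.
Qed.

Lemma ord0_lift n : ord0 = lift ord_max (ord0 : 'I_n.+1) :> 'I_n.+2.
Proof. by apply: val_inj; rewrite [RHS]lift_max. Qed.

End MultiIndex.

Section Tensor.
Variable N : nat.
Local Notation mindex n := {ffun 'I_n -> 'I_N}.

Definition ent (A : Type) n (X : 'M[A]_#|{: mindex n}|) (s t : mindex n) : A :=
  X (enum_rank s) (enum_rank t).

Lemma ent_inj (A : Type) n (X Y : 'M[A]_#|{: mindex n}|) : ent X =2 ent Y -> X = Y.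
Proof.
move=> e; apply/matrixP => a b; rewrite -(enum_valK a) -(enum_valK b).
exact: e.
Qed.

Section Ring.
Variable A : nzRingType.
Implicit Types n : nat.

Lemma entM n (X Y : 'M[A]_#|{: mindex n}|) s t :
  ent (X *m Y) s t = \sum_u ent X s u * ent Y u t.
Proof.
rewrite /ent mxE (reindex enum_rank) //.
by exists enum_val => i _; rewrite ?enum_rankK ?enum_valK.
Qed.

Lemma ent1 n s t : ent (1%:M : 'M[A]_#|{: mindex n}|) s t = (s == t)%:R.
Proof. by rewrite /ent mxE (inj_eq enum_rank_inj). Qed.

Lemma entB n (X Y : 'M[A]_#|{: mindex n}|) s t :
  ent (X - Y) s t = ent X s t - ent Y s t.
Proof. by rewrite /ent !mxE. Qed.

Lemma entZ n c (X : 'M[A]_#|{: mindex n}|) s t : ent (c *: X) s t = c * ent X s t.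
Proof. by rewrite /ent mxE. Qed.

(* X acting on the first n of n.+1 tensor factors. *)
Definition emb n (X : 'M[A]_#|{: mindex n}|) : 'M[A]_#|{: mindex n.+1}| :=
  \matrix_(a, b) let s : mindex n.+1 := enum_val a in
    let t : mindex n.+1 := enum_val b in
    ent X (belast_ffun s) (belast_ffun t) *+ (s ord_max == t ord_max).

Lemma ent_emb n (X : 'M[A]_#|{: mindex n}|) s t i j :
  ent (emb X) (snoc s i) (snoc t j) = ent X s t *+ (i == j).
Proof. by rewrite {1}/ent mxE /= !enum_rankK !belast_snoc !snoc_max. Qed.

Lemma embE n (X : 'M[A]_#|{: mindex n}|) Y :
  (forall s t i j, ent Y (snoc s i) (snoc t j) = ent X s t *+ (i == j)) ->
  Y = emb X.
Proof.
by move=> e; apply: ent_inj => s t; rewrite -(snoc_belast s) -(snoc_belast t)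
  e ent_emb.
Qed.

Lemma embM n (X Y : 'M[A]_#|{: mindex n}|) : emb (X * Y) = emb X * emb Y.
Proof.
symmetry; apply: embE => s t i j.
rewrite [LHS]entM [ent (X * Y) s t]entM sum_snoc -sumrMnl.
apply: eq_bigr => u _; rewrite (bigD1 i) //= big1 ?addr0 => [|k ki].
  by rewrite !ent_emb eqxx mulr1n mulrnAr.
by rewrite ent_emb eq_sym (negbTE ki) mulr0n mul0r.
Qed.

Lemma emb1 n : emb (1 : 'M[A]_#|{: mindex n}|) = 1.
Proof.
symmetry; apply: embE => s t i j.
by rewrite !ent1 eq_snoc -mulrnA mulnb.
Qed.

Lemma emb_scalar n c : emb (c%:M : 'M[A]_#|{: mindex n}|) = c%:M.
Proof.
symmetry; apply: embE => s t i j.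
by rewrite /ent !mxE !(inj_eq enum_rank_inj) eq_snoc -mulrnA mulnb.
Qed.

Lemma emb_is_zmod_morphism n : zmod_morphism (@emb n).
Proof.
move=> X Y; symmetry; apply: embE => s t i j.
by rewrite !entB !ent_emb mulrnBl.
Qed.

Lemma act_at_emb n k (X : 'M[A]_(N * N)) : (0 < k <= n)%N ->
  act_at n.+1 k X = emb (act_at n k X).
Proof.
case: k => // k kn; apply: embE => s t i j.
rewrite /ent /act_at !mxE /= !enum_rankK !inord_lift //; last exact: ltnW.
rewrite !snoc_lift (forall_snoc s t i j (fun r => (r != _) && (r != _))).
rewrite !(negbTE (neq_lift _ _)) -mulrnA mulnb; congr (_ *+ (_ && _)).
by apply: eq_forallb => r; rewrite !(inj_eq lift_inj).
Qed.

Lemma act1_emb n (L : 'M[A]_N) :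
  act1 (ord0 : 'I_n.+2) L = emb (act1 (ord0 : 'I_n.+1) L).
Proof.
apply: embE => s t i j.
rewrite /ent !mxE /= !enum_rankK ord0_lift !snoc_lift.
rewrite (forall_snoc s t i j (fun r => r != _)).
rewrite (negbTE (neq_lift _ _)) -mulrnA mulnb; congr (_ *+ (_ && _)).
by apply: eq_forallb => r; rewrite !(inj_eq lift_inj).
Qed.

(** Together with [act_at_emb], this formula reduces statements about X_k to the case where X acts
    in the last two factors. *)
Lemma ent_act_last n (X : 'M[A]_(N * N)) s t i j k l :
  ent (act_at n.+1 n.+1 X) (snoc (snoc s i) j) (snoc (snoc t k) l) =
  entry2 X i j k l *+ (s == t).
Proof.
have em : inord n.+1 = ord_max :> 'I_n.+2 by apply: val_inj; rewrite [LHS]inordK.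
have em' : inord n = ord_max :> 'I_n.+1 by apply: val_inj; rewrite [LHS]inordK.
rewrite {1}/ent /act_at !mxE /= !enum_rankK em inord_lift // em'.
rewrite !(snoc_lift, snoc_max); congr (_ *+ _).
rewrite (forall_snoc (snoc s i) (snoc t k) j l (fun r => (r != _) && (r != _))).
rewrite eqxx andbF andbT.
under eq_forallb => r do rewrite (inj_eq lift_inj) [lift _ _ == _]eq_sym neq_lift andbT.
rewrite (forall_snoc s t i k (fun r => r != _)) eqxx andbT.
congr nat_of_bool; apply/forallP/eqP => [st|-> r]; last by rewrite eqxx implybT.
by apply/ffunP => r; have := st r; rewrite [lift _ _ == _]eq_sym neq_lift => /eqP.
Qed.

HB.instance Definition _ n := GRing.isZmodMorphism.Build
  'M[A]_#|{: mindex n}| 'M[A]_#|{: mindex n.+1}| (@emb n) (@emb_is_zmod_morphism n).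

Lemma entry2_mul (X Y : 'M[A]_(N * N)) i j k l :
  entry2 (X *m Y) i j k l = \sum_a \sum_b entry2 X i j a b * entry2 Y a b k l.
Proof.
rewrite /entry2 mxE (reindex _ (curry_mxvec_bij _ _)) /= pair_bigA.
by apply: eq_bigr => -[a b] _.
Qed.

Lemma entry2_1 i j k l :
  entry2 (1%:M : 'M[A]_(N * N)) i j k l = ((i == k) && (j == l))%:R.
Proof.
rewrite /entry2 mxE; congr (_%:R); congr nat_of_bool.
rewrite /mxvec_index (inj_eq (@cast_ord_inj _ _ _)) (inj_eq enum_rank_inj).
exact: xpair_eqE.
Qed.

Lemma sum_snoc2 (V : nmodType) n (F : mindex n.+2 -> V) :
  \sum_u F u = \sum_u \sum_i \sum_j F (snoc (snoc u i) j).
Proof. by rewrite !sum_snoc. Qed.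

Lemma act_atM n k (X Y : 'M[A]_(N * N)) : (0 < k <= n)%N ->
  act_at n k (X *m Y) = act_at n k X * act_at n k Y.
Proof.
elim: n => [|n IH]; first by case: k.
case/andP=> k0; rewrite leq_eqVlt => /predU1P[->|kn]; last first.
  by rewrite !act_at_emb ?k0 // IH ?k0 // embM.
apply: ent_inj => s t; rewrite -(snoc_belast s) -(snoc_belast t).
rewrite -(snoc_belast (belast_ffun s)) -(snoc_belast (belast_ffun t)).
move: (belast_ffun (belast_ffun s)) (belast_ffun (belast_ffun t)) => s' t'.
rewrite ent_act_last entry2_mul [RHS]entM sum_snoc2 (bigD1 s') //= [X in _ + X]big1.
  rewrite addr0 -sumrMnl; apply: eq_bigr => a _; rewrite -sumrMnl; apply: eq_bigr => b _.
  by rewrite !ent_act_last eqxx mulr1n mulrnAr.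
move=> u; rewrite eq_sym => /negbTE us; rewrite big1 // => a _; rewrite big1 // => b _.
by rewrite ent_act_last us mulr0n mul0r.
Qed.

Lemma act_at1 n k : (0 < k <= n)%N -> act_at n k (1%:M : 'M[A]_(N * N)) = 1.
Proof.
elim: n => [|n IH]; first by case: k.
case/andP=> k0; rewrite leq_eqVlt => /predU1P[->|kn]; last first.
  by rewrite !act_at_emb ?k0 // IH ?k0 // emb1.
apply: ent_inj => s t; rewrite -(snoc_belast s) -(snoc_belast t).
rewrite -(snoc_belast (belast_ffun s)) -(snoc_belast (belast_ffun t)).
rewrite ent_act_last ent1 !eq_snoc entry2_1 -mulrnA mulnb; congr (_%:R).
by rewrite andbC andbA.
Qed.

Lemma act_atD n k (X Y : 'M[A]_(N * N)) :
  act_at n k (X + Y) = act_at n k X + act_at n k Y.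
Proof. by apply/matrixP => a b; rewrite !mxE /= /entry2 !mxE mulrnDl. Qed.

Lemma act_atZ n k c (X : 'M[A]_(N * N)) :
  act_at n k (c *: X) = c *: act_at n k X.
Proof. by apply/matrixP => a b; rewrite !mxE /= /entry2 !mxE mulrnAr. Qed.

(** The operators act in disjoint factors, so a single term survives in each entry of either
    product; its two coefficients commute because those of X are central. *)
Lemma emb_emb_comm n (Z : 'M[A]_#|{: mindex n}|) (X : 'M[A]_(N * N)) :
  (forall a i j, a * X i j = X i j * a) ->
  GRing.comm (emb (emb Z)) (act_at n.+1 n.+1 X).
Proof.
move=> cX; apply: ent_inj => s t; rewrite -(snoc_belast s) -(snoc_belast t).
rewrite -(snoc_belast (belast_ffun s)) -(snoc_belast (belast_ffun t)).
move: (belast_ffun (belast_ffun s)) (belast_ffun (belast_ffun t)) => s' t'.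
move: (belast_ffun s _) (s _) (belast_ffun t _) (t _) => i j k l.
rewrite [LHS]entM [RHS]entM !sum_snoc2.
rewrite (bigD1 t') //= [X in _ + X]big1 ?addr0; last first.
  move=> u /negbTE ut; rewrite big1 // => a _; rewrite big1 // => b _.
  by rewrite ent_act_last ut mulr0n mulr0.
rewrite (bigD1 i) //= [X in _ + X]big1 ?addr0; last first.
  move=> a ai; rewrite big1 // => b _.
  by rewrite !ent_emb [i == a]eq_sym (negbTE ai) mulr0n mul0rn mul0r.
rewrite (bigD1 j) //= [X in _ + X]big1 ?addr0; last first.
  by move=> b bj; rewrite !ent_emb [j == b]eq_sym (negbTE bj) mulr0n mul0r.
rewrite (bigD1 s') //= [X in _ = _ + X]big1 ?addr0; last first.
  move=> u; rewrite eq_sym => /negbTE ut; rewrite big1 // => a _; rewrite big1 // => b _.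
  by rewrite ent_act_last ut mulr0n mul0r.
rewrite [RHS](bigD1 k) //= [X in _ = _ + X]big1 ?addr0; last first.
  move=> a ai; rewrite big1 // => b _.
  by rewrite !ent_emb (negbTE ai) mulr0n mul0rn mulr0.
rewrite [RHS](bigD1 l) //= [X in _ = _ + X]big1 ?addr0; last first.
  by move=> b bj; rewrite !ent_emb (negbTE bj) mulr0n mulr0.
by rewrite !ent_act_last !ent_emb !eqxx !mulr1n cX.
Qed.

Lemma act_at_far n i j (X Y : 'M[A]_(N * N)) :
  (forall a k l, a * Y k l = Y k l * a) -> (0 < i)%N -> (i.+1 < j <= n)%N ->
  GRing.comm (act_at n i X) (act_at n j Y).
Proof.
move=> cY i0; elim: n => [|n IH] /andP[ij].
  by rewrite leqn0 => /eqP ej; rewrite ej in ij.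
rewrite leq_eqVlt => /predU1P[ej|jn]; last first.
  have i_n : (i <= n)%N by rewrite -ltnS (ltn_trans _ jn) // (ltn_trans _ ij).
  rewrite !act_at_emb ?i0 ?i_n ?(ltn_trans _ ij) //=.
  by rewrite /GRing.comm -!embM IH // ij.
rewrite ej ltnS in ij *; case: n ij {IH ej} => // n i_n.
have -> : act_at n.+2 i X = emb (emb (act_at n i X)).
  by rewrite act_at_emb ?i0 /= 1?ltnW // act_at_emb ?i0.
exact: emb_emb_comm.
Qed.

Lemma act1_far n j (L : 'M[A]_N) (Y : 'M[A]_(N * N)) :
  (forall a k l, a * Y k l = Y k l * a) -> (1 < j <= n)%N ->
  GRing.comm (act1 (ord0 : 'I_n.+1) L) (act_at n j Y).
Proof.
move=> cY; elim: n => [|n IH] /andP[j1].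
  by rewrite leqn0 => /eqP ej; rewrite ej in j1.
rewrite leq_eqVlt => /predU1P[ej|jn]; last first.
  rewrite act1_emb act_at_emb ?(ltnW j1) //.
  by rewrite /GRing.comm -!embM IH // j1.
rewrite ej ltnS in j1 *; case: n j1 {IH ej} => // n _.
by rewrite !act1_emb; apply: emb_emb_comm.
Qed.

(** The operator Y acts in the last three factors only, with kernel y. This serves to carry
    identities on the third tensor power to longer ones. *)
Definition local3 n (Y : 'M[A]_#|{: mindex n.+3}|)
    (y : 'I_N -> 'I_N -> 'I_N -> 'I_N -> 'I_N -> 'I_N -> A) :=
  forall s t i j k a b c,
    ent Y (snoc (snoc (snoc s i) j) k) (snoc (snoc (snoc t a) b) c) =
    y i j k a b c *+ (s == t).

Lemma local3M n (Y Z : 'M[A]_#|{: mindex n.+3}|) y z :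
  local3 Y y -> local3 Z z ->
  local3 (Y * Z) (fun i j k a b c =>
    \sum_d \sum_e \sum_f y i j k d e f * z d e f a b c).
Proof.
move=> hY hZ s t i j k a b c; rewrite [LHS]entM !sum_snoc.
rewrite (bigD1 s) //= [X in _ + X]big1 ?addr0; last first.
  move=> u; rewrite eq_sym => /negbTE us; rewrite big1 // => d _.
  by rewrite big1 // => e _; rewrite big1 // => f _; rewrite hY us mulr0n mul0r.
rewrite -sumrMnl; apply: eq_bigr => d _; rewrite -sumrMnl; apply: eq_bigr => e _.
rewrite -sumrMnl; apply: eq_bigr => f _.
by rewrite hY hZ eqxx mulr1n mulrnAr.
Qed.

Lemma local3_12 n X : local3 (act_at n.+2 n.+1 X)
  (fun i j k a b c => entry2 X i j a b *+ (k == c)).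
Proof.
move=> s t i j k a b c; rewrite act_at_emb ?ltnS ?leqnn //.
by rewrite ent_emb ent_act_last -!mulrnA mulnC.
Qed.

Lemma local3_23 n X : local3 (act_at n.+2 n.+2 X)
  (fun i j k a b c => entry2 X j k b c *+ (i == a)).
Proof.
move=> s t i j k a b c; rewrite ent_act_last eq_snoc -mulrnA.
by rewrite mulnb andbC.
Qed.

(** On exactly three factors the kernel can be read off from the operator, so equal operators have
    equal kernels; the kernel in turn determines the operator on any number of factors. *)
Lemma local3_transfer m (Y Z : 'M[A]_#|{: mindex 3}|)
    (Y' Z' : 'M[A]_#|{: mindex m.+3}|) y z :
  local3 Y y -> local3 Z z -> local3 Y' y -> local3 Z' z -> Y = Z -> Y' = Z'.
Proof.
move=> hY hZ hY' hZ' YZ; have s0 : mindex 0 by apply: finfun; case.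
have yz i j k a b c : y i j k a b c = z i j k a b c.
  by have := hY s0 s0 i j k a b c; rewrite YZ hZ eqxx !mulr1n => ->.
apply: ent_inj => s t; rewrite -(snoc_belast s) -(snoc_belast t).
rewrite -(snoc_belast (belast_ffun s)) -(snoc_belast (belast_ffun t)).
rewrite -(snoc_belast (belast_ffun (belast_ffun s))).
rewrite -(snoc_belast (belast_ffun (belast_ffun t))).
by rewrite hY' hZ' yz.
Qed.

Lemma act_at_braid n k (X : 'M[A]_(N * N)) : (0 < k < n)%N ->
  act_at 2 1 X * act_at 2 2 X * act_at 2 1 X =
    act_at 2 2 X * act_at 2 1 X * act_at 2 2 X ->
  act_at n k X * act_at n k.+1 X * act_at n k X =
    act_at n k.+1 X * act_at n k X * act_at n k.+1 X.
Proof.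
move=> /andP[k0 kn] br; elim: n kn => // n IH; rewrite ltnS leq_eqVlt.
case/predU1P=> [<-|kn]; last first.
  by rewrite !act_at_emb ?k0 // ?(ltnW kn) // -!embM IH.
case: k k0 {IH} => // k _.
apply: (local3_transfer _ _ _ _ br);
  by do 2?[apply: local3M]; by [apply: local3_12 | apply: local3_23].
Qed.

End Ring.

(** * Partial R-traces and the skew inverse *)

Section PartialTrace.
Variables (K : fieldType) (A : algType K) (R Psi : 'M[K]_(N * N)).
Let C := Cmx Psi.

(* The R-trace over the last tensor factor. *)
Definition ptr n (X : 'M[A]_#|{: mindex n.+1}|) : 'M[A]_#|{: mindex n}| :=
  \matrix_(a, b) \sum_i \sum_j
    C j i *: ent X (snoc (enum_val a) i) (snoc (enum_val b) j).

Lemma ent_ptr n (X : 'M[A]_#|{: mindex n.+1}|) s t :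
  ent (ptr X) s t = \sum_i \sum_j C j i *: ent X (snoc s i) (snoc t j).
Proof. by rewrite {1}/ent mxE !enum_rankK. Qed.

(** With [ptr_embr], this makes the partial R-trace a bimodule map over the operators on the
    remaining factors, so that they can be pulled out on either side. *)
Lemma ptr_embl n (X : 'M[A]_#|{: mindex n}|) Y : ptr (emb X * Y) = X * ptr Y.
Proof.
apply: ent_inj => s t; rewrite [RHS]entM ent_ptr.
under [RHS]eq_bigr => u _ do rewrite ent_ptr mulr_sumr.
rewrite [RHS]exchange_big; apply: eq_bigr => i _ /=.
under [RHS]eq_bigr => u _ do rewrite mulr_sumr.
rewrite [RHS]exchange_big; apply: eq_bigr => j _ /=.
rewrite entM sum_snoc scaler_sumr; apply: eq_bigr => u _.
rewrite (bigD1 i) //= big1 ?addr0 => [|k ki].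
  by rewrite ent_emb eqxx mulr1n -scalerAr.
by rewrite ent_emb eq_sym (negbTE ki) mulr0n mul0r.
Qed.

Lemma ptr_embr n (X : 'M[A]_#|{: mindex n}|) Y : ptr (Y * emb X) = ptr Y * X.
Proof.
apply: ent_inj => s t; rewrite [RHS]entM ent_ptr.
under [RHS]eq_bigr => u _ do rewrite ent_ptr mulr_suml.
rewrite [RHS]exchange_big; apply: eq_bigr => i _ /=.
under [RHS]eq_bigr => u _ do rewrite mulr_suml.
rewrite [RHS]exchange_big; apply: eq_bigr => j _ /=.
rewrite entM sum_snoc scaler_sumr; apply: eq_bigr => u _.
rewrite (bigD1 j) //= big1 ?addr0 => [|k ki].
  by rewrite ent_emb eqxx mulr1n -scalerAl.
by rewrite ent_emb (negbTE ki) mulr0n mulr0.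
Qed.

Lemma ptrZ n (c : K) (X : 'M[A]_#|{: mindex n.+1}|) :
  ptr (c%:A *: X) = c%:A *: ptr X.
Proof.
apply/matrixP => a b; rewrite !mxE mulr_sumr; apply: eq_bigr => i _.
rewrite mulr_sumr; apply: eq_bigr => j _.
by rewrite /ent [(_ *: X) _ _]mxE scalerAr.
Qed.

(** The weight is a product of entries of C over the factors, so its last term splits off and the
    R-trace can be taken one factor at a time. *)
Lemma Rtrace_ptr n (X : 'M[A]_#|{: mindex n.+1}|) :
  Rtrace Psi X = Rtrace Psi (ptr X).
Proof.
rewrite /Rtrace sum_snoc; apply: eq_bigr => s _.
under eq_bigr => i _ do rewrite sum_snoc.
rewrite exchange_big; apply: eq_bigr => t _ /=.
rewrite -/(ent (ptr X) s t) ent_ptr scaler_sumr; apply: eq_bigr => i _.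
rewrite scaler_sumr; apply: eq_bigr => j _; rewrite scalerA big_ord_recr /=.
rewrite !snoc_max; congr (_ * _ *: _); apply: eq_bigr => r _.
have -> : widen_ord (leqnSn n) r = lift ord_max r.
  by apply: val_inj; rewrite [RHS]lift_max.
by rewrite !snoc_lift.
Qed.

Lemma Rtrace_tail_ptr n (X : 'M[A]_#|{: mindex n.+2}|) :
  Rtrace_tail Psi X = Rtrace_tail Psi (ptr X).
Proof.
apply/matrixP => a b; rewrite !mxE big_mkcond [RHS]big_mkcond sum_snoc.
apply: eq_bigr => s _; rewrite ord0_lift.
under eq_bigr => i _ do rewrite snoc_lift.
case: ifP => _; last by rewrite big1.
under eq_bigr => i _ do rewrite big_mkcond sum_snoc.
rewrite exchange_big [RHS]big_mkcond; apply: eq_bigr => t _ /=.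
under eq_bigr => i _ do under eq_bigr => j _ do rewrite snoc_lift.
case: ifP => _; last by rewrite big1 // => i _; rewrite big1.
rewrite -/(ent (ptr X) s t) ent_ptr scaler_sumr; apply: eq_bigr => i _.
rewrite scaler_sumr; apply: eq_bigr => j _; rewrite scalerA.
rewrite [in LHS]big_mkcond big_ord_recr /= -ord0_lift [in RHS]big_mkcond.
rewrite !snoc_max; congr (_ * _ *: _); apply: eq_bigr => r _.
have -> : widen_ord (leqnSn n.+1) r = lift ord_max r.
  by apply: val_inj; rewrite [RHS]lift_max.
by rewrite !snoc_lift ord0_lift (inj_eq lift_inj).
Qed.

Hypothesis R_skew_inv : skew_inverse R Psi.

(** The entries of Tr_{R(2)} R_1 = I, obtained from the defining relation of Psi by setting q' = p
    and summing over p. *)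
Lemma skew_inverse_trace i k :
  \sum_j \sum_l entry2 R i j k l * C l j = (i == k)%:R.
Proof.
transitivity (\sum_p (\sum_j \sum_l entry2 R i j k l * entry2 Psi l p j p)).
  rewrite [RHS]exchange_big; apply: eq_bigr => j _ /=; rewrite [RHS]exchange_big.
  by apply: eq_bigr => l _ /=; rewrite /C mxE mulr_sumr.
under eq_bigr => p _ do rewrite R_skew_inv.
rewrite (bigD1 k) //= eqxx andbT big1 ?addr0 // => p /negbTE pk.
by rewrite pk andbF.
Qed.

(** After regrouping the indices as U_{(ik),(jl)} = R_{ij}^{kl} and V_{(jl),(ap)} = Psi_{lp}^{ja},
    skew-invertibility says U V = I, and a right inverse of a square matrix is also a left
    inverse. *)
Lemma skew_inverse_left j l b d :
  \sum_a \sum_p entry2 Psi l p j a * entry2 R a b p d = ((j == b) && (l == d))%:R.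
Proof.
pose U : 'M[K]_(N * N) := \matrix_(x, y)
  let: (i, k) := (enum_val (cast_ord (esym (mxvec_cast N N)) x)) in
  let: (j, l) := (enum_val (cast_ord (esym (mxvec_cast N N)) y)) in
  entry2 R i j k l.
pose V : 'M[K]_(N * N) := \matrix_(x, y)
  let: (j, l) := (enum_val (cast_ord (esym (mxvec_cast N N)) x)) in
  let: (a, p) := (enum_val (cast_ord (esym (mxvec_cast N N)) y)) in
  entry2 Psi l p j a.
have UE x y z w : entry2 U x y z w = entry2 R x z y w.
  by rewrite /entry2 mxE /mxvec_index !cast_ordK !enum_rankK.
have VE x y z w : entry2 V x y z w = entry2 Psi y w x z.
  by rewrite /entry2 mxE /mxvec_index !cast_ordK !enum_rankK.
have UV : U *m V = 1%:M.
  apply/matrixP => x y; case/mxvec_indexP: x => i k; case/mxvec_indexP: y => a p.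
  rewrite -/(entry2 _ i k a p) -[RHS]/(entry2 _ i k a p) entry2_mul entry2_1.
  rewrite [k == p]eq_sym -(R_skew_inv i k p a).
  by apply: eq_bigr => j' _; apply: eq_bigr => l' _; rewrite UE VE.
have VU := mulmx1C UV.
have := congr1 (fun W => entry2 W j l b d) VU; rewrite entry2_mul entry2_1 => <-.
by apply: eq_bigr => a _; apply: eq_bigr => p _; rewrite UE VE.
Qed.

End PartialTrace.
End Tensor.

Lemma sum_delta (V : nmodType) (I : finType) (F : I -> V) i :
  \sum_j F j *+ (i == j) = F i.
Proof.
rewrite (bigD1 i) //= eqxx big1 ?addr0 // => j /negbTE.
by rewrite eq_sym => ->.
Qed.

Lemma exchange_big3 (V : nmodType) (I J L : finType) (F : I -> J -> L -> V) :
  \sum_i \sum_j \sum_l F i j l = \sum_l \sum_i \sum_j F i j l.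
Proof.
rewrite [RHS]exchange_big; apply: eq_bigr => i _ /=.
by rewrite [RHS]exchange_big.
Qed.

(** * R-traces of R and of conjugates by R *)

Section BraidedTrace.
Variable N : nat.
Local Notation mindex n := {ffun 'I_n -> 'I_N}.

Section Local3.
Variables (A : nzRingType) (n : nat) (Y : 'M[A]_#|{: mindex n.+3}|).
Variable y : 'I_N -> 'I_N -> 'I_N -> 'I_N -> 'I_N -> 'I_N -> A.
Hypothesis Yy : local3 Y y.

Lemma local3M_12 X : local3 (Y * act_at n.+2 n.+1 X) (fun i j k a b c =>
  \sum_d \sum_e y i j k d e c * entry2 X d e a b).
Proof.
move=> s t i j k a b c; rewrite (local3M Yy (local3_12 X)); congr (_ *+ _).
apply: eq_bigr => d _; apply: eq_bigr => e _.
under eq_bigr => f _ do rewrite mulrnAr eq_sym.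
exact: sum_delta.
Qed.

Lemma local3M_23 X : local3 (Y * act_at n.+2 n.+2 X) (fun i j k a b c =>
  \sum_e \sum_f y i j k a e f * entry2 X e f b c).
Proof.
move=> s t i j k a b c; rewrite (local3M Yy (local3_23 X)); congr (_ *+ _).
rewrite exchange_big; apply: eq_bigr => e _; rewrite exchange_big.
apply: eq_bigr => f _ /=.
under eq_bigr => d _ do rewrite mulrnAr eq_sym.
exact: sum_delta.
Qed.
End Local3.

Section Conjugation.
Variables (K : fieldType) (R RI Psi : 'M[K]_(N * N)).
Hypotheses (RRI : R *m RI = 1%:M) (RIR : RI *m R = 1%:M).
Hypothesis R_skew_inv : skew_inverse R Psi.
Hypothesis R_braid : braid_relation R.
Let C := Cmx Psi.

(** The entries of R_2 R_1 R_2^(-1) = R_1^(-1) R_2 R_1, which is the braid relation multiplied by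
    inverses on both sides. *)
Lemma braid_entries i j k a b c :
  \sum_x \sum_y \sum_z entry2 R j k x y * entry2 R i x a z * entry2 RI z y b c =
  \sum_x \sum_y \sum_z entry2 RI i j x y * entry2 R y k z c * entry2 R x z a b.
Proof.
have br : act_at 2 2 R * act_at 2 1 R * act_at 2 2 RI =
    act_at 2 1 RI * act_at 2 2 R * act_at 2 1 R.
  have inv1 : act_at 2 1 RI * act_at 2 1 R = 1 by rewrite -act_atM // RIR act_at1.
  have inv2 : act_at 2 2 R * act_at 2 2 RI = 1 by rewrite -act_atM // RRI act_at1.
  have Rb : act_at 2 1 R * act_at 2 2 R * act_at 2 1 R =
    act_at 2 2 R * act_at 2 1 R * act_at 2 2 R := R_braid.
  transitivity (act_at 2 1 RI * (act_at 2 1 R * act_at 2 2 R * act_at 2 1 R)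
     * act_at 2 2 RI); first by rewrite !mulrA inv1 mul1r.
  by rewrite Rb -!mulrA inv2 mulr1.
have s0 : mindex 0 by apply: finfun; case.
have L := local3M_23 (local3M_12 (@local3_23 _ _ 0 R) R) RI.
have Rr := local3M_12 (local3M_23 (@local3_12 _ _ 0 RI) R) R.
have := L s0 s0 i j k a b c; rewrite br Rr eqxx !mulr1n => e.
transitivity (\sum_x \sum_y (\sum_d \sum_z entry2 R j k z y *+ (i == d) *
   entry2 R d z a x) * entry2 RI x y b c).
  under [RHS]eq_bigr => x _ do under eq_bigr => y _ do rewrite mulr_suml.
  rewrite [RHS]exchange_big3.
  under [RHS]eq_bigr => d _ do under eq_bigr => x _ do under eq_bigr => y _ do
    rewrite mulr_suml.
  under [RHS]eq_bigr => d _ do rewrite exchange_big3.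
  rewrite [RHS]exchange_big; apply: eq_bigr => x _ /=.
  rewrite exchange_big [RHS]exchange_big; apply: eq_bigr => z _ /=.
  rewrite [RHS]exchange_big; apply: eq_bigr => y _ /=.
  under [RHS]eq_bigr => d _ do rewrite -mulrA mulrnAl mulrA.
  by rewrite sum_delta.
rewrite -e.
transitivity (\sum_x \sum_y (\sum_d \sum_z entry2 RI i j x d *+ (k == z) *
   entry2 R d z y c) * entry2 R x y a b); first by [].
apply: eq_bigr => x _; rewrite [RHS]exchange_big; apply: eq_bigr => z _ /=.
rewrite mulr_suml; apply: eq_bigr => y _.
under eq_bigr => d _ do rewrite mulrnAl.
by rewrite sum_delta.
Qed.

(** Contracting [braid_entries] with Psi over i and a removes the middle factor R on its left side,
    since Psi is a left skew inverse. *)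
Lemma skew_inverse_contract j k b c g l :
  \sum_y entry2 R j k g y * entry2 RI l y b c =
  \sum_i \sum_a entry2 Psi l a g i *
    \sum_x \sum_y \sum_z entry2 RI i j x y * entry2 R y k z c * entry2 R x z a b.
Proof.
under [RHS]eq_bigr => i _ do under eq_bigr => a _ do rewrite -braid_entries mulr_sumr.
rewrite [RHS]exchange_big3.
transitivity (\sum_x (\sum_y entry2 R j k x y * entry2 RI l y b c) *+ (g == x)).
  by rewrite sum_delta.
apply: eq_bigr => x _.
under [RHS]eq_bigr => i _ do under eq_bigr => a _ do rewrite mulr_sumr.
rewrite [RHS]exchange_big3 -sumrMnl; apply: eq_bigr => y _.
under [RHS]eq_bigr => i _ do under eq_bigr => a _ do rewrite mulr_sumr.
rewrite [RHS]exchange_big3.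
transitivity (\sum_z entry2 R j k x y * entry2 RI z y b c *+ (g == x) *+ (l == z)).
  by rewrite sum_delta.
apply: eq_bigr => z _; rewrite -mulrnA mulnb.
transitivity (entry2 R j k x y * entry2 RI z y b c *
    \sum_i \sum_a entry2 Psi l a g i * entry2 R i x a z).
  by rewrite (skew_inverse_left R_skew_inv) mulr_natr.
rewrite mulr_sumr; apply: eq_bigr => i _; rewrite mulr_sumr; apply: eq_bigr => a _.
by rewrite mulrCA; congr (_ * _); rewrite mulrAC.
Qed.

(* The local form of Tr_{R(2)} (R X_1 R^-1) = (Tr_R X) I. *)
Lemma R_conj_trace j g l b :
  \sum_k \sum_c (\sum_y entry2 R j k g y * entry2 RI l y b c) * C c k =
  C l g *+ (j == b).
Proof.
under eq_bigr => k _ do under eq_bigr => c _ do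
  rewrite skew_inverse_contract mulr_suml.
rewrite exchange_big3.
(* The factor R_{yk}^{zc} contracts with C to a delta forcing y = z; the two other factors then give
   R^(-1) R = I, and the remaining trace of Psi is C. *)
transitivity (\sum_i \sum_a entry2 Psi l a g i *+ (i == a) *+ (j == b)).
  apply: eq_bigr => i _.
  under eq_bigr => k _ do under eq_bigr => c _ do rewrite mulr_suml.
  rewrite exchange_big3; apply: eq_bigr => a _.
  transitivity (entry2 Psi l a g i * \sum_x \sum_y entry2 RI i j x y * entry2 R x y a b).
    under eq_bigr => k _ do under eq_bigr => c _ do
      rewrite -mulrA mulr_suml mulr_sumr.
    rewrite exchange_big3 mulr_sumr; apply: eq_bigr => x _.
    under eq_bigr => k _ do under eq_bigr => c _ do rewrite mulr_suml mulr_sumr.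
    rewrite exchange_big3 mulr_sumr; apply: eq_bigr => y _.
    under eq_bigr => k _ do under eq_bigr => c _ do rewrite mulr_suml mulr_sumr.
    rewrite exchange_big3.
    transitivity (\sum_z entry2 Psi l a g i * (entry2 RI i j x y * entry2 R x z a b)
       *+ (y == z)); last by rewrite sum_delta.
    apply: eq_bigr => z _; rewrite -mulr_natr -(skew_inverse_trace R_skew_inv).
    rewrite mulr_sumr; apply: eq_bigr => k _; rewrite mulr_sumr.
    apply: eq_bigr => c _; ring.
  by rewrite -entry2_mul RIR entry2_1 mulr_natr -mulnb mulrnA.
under eq_bigr => i _ do rewrite sumrMnl sum_delta.
by rewrite sumrMnl /C mxE.
Qed.

Section Tower.
Variable A : algType K.

Lemma ent_liftmx n (X : 'M[K]_#|{: mindex n}|) s t :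
  ent (liftmx A X) s t = (ent X s t)%:A.
Proof. by rewrite /ent mxE. Qed.

Lemma algMn (c : K) k : (c *+ k)%:A = c%:A *+ k :> A.
Proof. by rewrite scalerMnl. Qed.

Lemma ptr_R n : ptr Psi (liftmx A (act_at n.+1 n.+1 R)) = 1.
Proof.
apply: ent_inj => s t; rewrite ent_ptr ent1 -(snoc_belast s) -(snoc_belast t).
move: (belast_ffun s) (s _) (belast_ffun t) (t _) => s' i t' k.
transitivity ((i == k)%:R *: (s' == t')%:R : A); last first.
  by rewrite eq_snoc andbC scaler_nat -mulnb mulnC natrM mulr_natr.
rewrite -(skew_inverse_trace R_skew_inv).
rewrite scaler_suml; apply: eq_bigr => j _; rewrite scaler_suml; apply: eq_bigr => l _.
by rewrite ent_liftmx ent_act_last algMn [in RHS]mulrC -[RHS]scalerA scalerMnr.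
Qed.

(** The entries of R and R^(-1) are scalars, so they can be collected in front of each entry of X,
    where [R_conj_trace] applies. *)
Lemma ptr_conj n (X : 'M[A]_#|{: mindex n.+1}|) :
  ptr Psi (liftmx A (act_at n.+1 n.+1 R) * emb X * liftmx A (act_at n.+1 n.+1 RI)) =
  emb (ptr Psi X).
Proof.
apply: embE => s t j b; rewrite !ent_ptr.
have RX k l y : ent (liftmx A (act_at n.+1 n.+1 R) * emb X)
    (snoc (snoc s j) k) (snoc (snoc t l) y) =
    \sum_g entry2 R j k g y *: ent X (snoc s g) (snoc t l).
  rewrite [LHS]entM sum_snoc2 (bigD1 s) //= [X in _ + X]big1 ?addr0; last first.
    move=> u; rewrite eq_sym => /negbTE us; rewrite big1 // => g _.
    by rewrite big1 // => z _; rewrite ent_liftmx ent_act_last us scale0r mul0r.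
  apply: eq_bigr => g _; rewrite -[RHS](sum_delta (fun z => _ *: _) y).
  apply: eq_bigr => z _; rewrite ent_liftmx ent_act_last eqxx mulr1n ent_emb.
  by rewrite mulr_algl scalerMnr [y == z]eq_sym; case: eqP => [->|_] //;
    rewrite !mulr0n !scaler0.
transitivity (\sum_k \sum_c \sum_l \sum_y \sum_g
  (entry2 R j k g y * entry2 RI l y b c * C c k) *: ent X (snoc s g) (snoc t l)).
  apply: eq_bigr => k _; apply: eq_bigr => c _.
  rewrite [ent (_ * _) _ _]entM sum_snoc2 (bigD1 t) //= [X in _ + X]big1 ?addr0;
    last first.
    move=> u /negbTE ut; rewrite big1 // => l _; rewrite big1 // => y _.
    by rewrite ent_liftmx ent_act_last ut mulr0n scale0r mulr0.
  rewrite scaler_sumr; apply: eq_bigr => l _; rewrite scaler_sumr; apply: eq_bigr => y _.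
  rewrite RX ent_liftmx ent_act_last eqxx mulr1n mulr_algr scalerA scaler_sumr.
  by apply: eq_bigr => g _; rewrite scalerA; congr (_ *: _); ring.
rewrite exchange_big3 [in RHS]exchange_big -sumrMnl; apply: eq_bigr => l _ /=.
under eq_bigr => k _ do under eq_bigr => c _ do rewrite exchange_big.
rewrite exchange_big3 -sumrMnl; apply: eq_bigr => g _ /=.
rewrite scalerMnl -R_conj_trace scaler_suml; apply: eq_bigr => k _.
rewrite scaler_suml; apply: eq_bigr => c _.
by rewrite mulr_suml scaler_suml.
Qed.

End Tower.
End Conjugation.
End BraidedTrace.

(** * R-traces over all factors but the first *)

Section Tail.
Variables (N : nat) (K : fieldType) (A : algType K) (Psi : 'M[K]_(N * N)).
Local Notation mindex n := {ffun 'I_n -> 'I_N}.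

(** With a single factor nothing is traced out; [s0] is the empty multi-index. *)
Lemma Rtrace_tail0 (s0 : mindex 0) (X : 'M[A]_#|{: mindex 1}|) i j :
  Rtrace_tail Psi X i j = ent X (snoc s0 i) (snoc s0 j).
Proof.
have ord0E : ord0 = ord_max :> 'I_1 by apply: val_inj.
have snocE k (s : mindex 1) : (s ord0 == k) = (s == snoc s0 k).
  rewrite -(snoc_belast s); move: (belast_ffun s) (s ord_max) => s' l.
  by rewrite eq_snoc ord0E snoc_max (mindex0_eq s' s0) eqxx.
rewrite mxE (eq_bigl _ _ (snocE i)) big_pred1_eq (eq_bigl _ _ (snocE j)) big_pred1_eq.
by rewrite big_pred0 ?scale1r // => r; rewrite ord1 eqxx.
Qed.

Lemma Rtrace_tail0M (X Y : 'M[A]_#|{: mindex 1}|) :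
  Rtrace_tail Psi (X * Y) = Rtrace_tail Psi X *m Rtrace_tail Psi Y.
Proof.
have s0 : mindex 0 by apply: finfun; case.
apply/matrixP => i j; rewrite (Rtrace_tail0 s0) [LHS]entM sum_snoc mxE.
rewrite (big_pred1 s0) => [|s]; last by rewrite /= (mindex0_eq s s0) eqxx.
by apply: eq_bigr => k _; rewrite !(Rtrace_tail0 s0).
Qed.

Lemma Rtrace_tail0_act1 (L : 'M[A]_N) : Rtrace_tail Psi (act1 (ord0 : 'I_1) L) = L.
Proof.
have s0 : mindex 0 by apply: finfun; case.
have ord0E : ord0 = ord_max :> 'I_1 by apply: val_inj.
apply/matrixP => i j; rewrite (Rtrace_tail0 s0) /ent mxE /= !enum_rankK.
rewrite ord0E !snoc_max (_ : [forall r, _] = true) //.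
by apply/forallP => r; rewrite (ord1 r) (ord1 ord_max) eqxx.
Qed.

Lemma Rtrace_tail0_emb (X : 'M[A]_#|{: mindex 0}|) :
  Rtrace_tail Psi (emb X) = (Rtrace Psi X)%:M.
Proof.
have s0 : mindex 0 by apply: finfun; case.
apply/matrixP => i j; rewrite (Rtrace_tail0 s0) ent_emb mxE; congr (_ *+ _).
have E : xpredT =1 pred1 s0 by move=> s /=; rewrite (mindex0_eq s s0) eqxx.
by rewrite /Rtrace (big_pred1 s0 E) (big_pred1 s0 E) big_ord0 scale1r.
Qed.

Lemma Rtrace_tail_act1l n (L : 'M[A]_N) (X : 'M[A]_#|{: mindex n.+1}|) :
  Rtrace_tail Psi (act1 ord0 L * X) = L *m Rtrace_tail Psi X.
Proof.
elim: n X => [|n IH] X; first by rewrite Rtrace_tail0M Rtrace_tail0_act1.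
by rewrite !Rtrace_tail_ptr act1_emb ptr_embl IH.
Qed.

Lemma Rtrace_tail_act1r n (L : 'M[A]_N) (X : 'M[A]_#|{: mindex n.+1}|) :
  Rtrace_tail Psi (X * act1 ord0 L) = Rtrace_tail Psi X *m L.
Proof.
elim: n X => [|n IH] X; first by rewrite Rtrace_tail0M Rtrace_tail0_act1.
by rewrite !Rtrace_tail_ptr act1_emb ptr_embr IH.
Qed.

Lemma Rtrace_tailZ n (c : K) (X : 'M[A]_#|{: mindex n.+1}|) :
  Rtrace_tail Psi (c%:A *: X) = c%:A *: Rtrace_tail Psi X.
Proof.
apply/matrixP => i j; rewrite !mxE mulr_sumr; apply: eq_bigr => s _.
rewrite mulr_sumr; apply: eq_bigr => t _.
by rewrite [(_ *: X) _ _]mxE scalerAr.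
Qed.

Lemma Rtrace_tail_is_zmod_morphism n :
  zmod_morphism (@Rtrace_tail N K Psi A n).
Proof.
move=> X Y; apply/matrixP => i j; rewrite !mxE -sumrB; apply: eq_bigr => s _.
rewrite -sumrB; apply: eq_bigr => t _.
by rewrite [(X - Y) _ _]mxE [(- Y) _ _]mxE scalerBr.
Qed.

HB.instance Definition _ n := GRing.isZmodMorphism.Build
  'M[A]_#|{: mindex n.+1}| 'M[A]_N (@Rtrace_tail N K Psi A n)
  (@Rtrace_tail_is_zmod_morphism n).

Lemma Rtrace_tail_sum n (I : finType) (F : I -> 'M[A]_#|{: mindex n.+1}|) :
  Rtrace_tail Psi (\sum_i F i) = \sum_i Rtrace_tail Psi (F i).
Proof. exact: raddf_sum. Qed.

End Tail.

(** * Antisymmetrizers of the Hecke algebra *)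

Section Qint.
Variables (K : fieldType) (q : K).
Hypotheses (q0 : q != 0) (q1 : forall n : int, n != 0 -> q ^ n != 1).

Lemma q_sub_inv_neq0 : q - q^-1 != 0.
Proof.
rewrite subr_eq0; apply: contraNneq (q1 (n := 2) isT) => e.
by rewrite -[q ^ 2]/(q * q) {1}e mulVf.
Qed.

Lemma qint_neq0 k : qint q k.+1 != 0.
Proof.
rewrite /qint mulf_neq0 ?invr_eq0 ?q_sub_inv_neq0 // subr_eq0.
apply: contraNneq (q1 (n := Posz (k.+1 + k.+1)) isT) => e.
by rewrite -[q ^ _]/(q ^+ _) exprD {1}e mulVf ?expf_neq0.
Qed.

Lemma qint1 : qint q 1 = 1.
Proof. by rewrite /qint divff ?q_sub_inv_neq0. Qed.

Lemma qintSl k : qint q k.+1 = q ^+ k + q^-1 * qint q k.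
Proof.
have h := q_sub_inv_neq0; apply: (mulIf h).
rewrite /qint divfK // [RHS]mulrDl -[_ * _ * (q - _)]mulrA divfK //.
by rewrite exprS; field; rewrite q0 expf_neq0.
Qed.

Lemma qintSr k : qint q k.+1 = q * qint q k + q ^- k.
Proof.
have h := q_sub_inv_neq0; apply: (mulIf h).
rewrite /qint divfK // [RHS]mulrDl -[_ * _ * (q - _)]mulrA divfK //.
by rewrite exprS; field; rewrite q0 expf_neq0.
Qed.

(** The signs cancel and the terms become q^(k-2j). The unsimplified form is the factor by which the
    signed sum of words in [asym_cosets] acts on an antisymmetric operator. *)
Lemma qint_sum k :
  \sum_(j < k.+1) ((-1) ^+ j * q ^+ (k - j)) * (- q^-1) ^+ j = qint q k.+1.
Proof.
elim: k => [|k IH]; first by rewrite big_ord1 /= !expr0 !mul1r qint1.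
rewrite big_ord_recr /= qintSr -IH mulr_sumr; congr (_ + _).
  apply: eq_bigr => j _; rewrite subSn ?leq_ord // exprS; ring.
rewrite subnn expr0 mulr1 -exprMn mulN1r opprK exprVn //.
Qed.

End Qint.

Section Matrices.
Variables (K : comNzRingType) (d : nat).
Lemma mxZl (c : K) (X Y : 'M[K]_d) : c *: X * Y = c *: (X * Y).
Proof. by symmetry; apply: scalemxAl. Qed.
Lemma mxZr (c : K) (X Y : 'M[K]_d) : X * (c *: Y) = c *: (X * Y).
Proof. by symmetry; apply: scalemxAr. Qed.
Lemma mx_scalarl (c : K) (X : 'M[K]_d) : c%:M * X = c *: X.
Proof. exact: mul_scalar_mx. Qed.
Lemma mx_scalarr (c : K) (X : 'M[K]_d) : X * c%:M = c *: X.
Proof. exact: mul_mx_scalar. Qed.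
End Matrices.

(** The product runs from g_{j-1} down to g_0; for the inverse generators it is the inverse of the
    word g_0 ... g_{j-1}. *)
Fixpoint rev_prod (H : pzRingType) (g : nat -> H) (j : nat) : H :=
  if j is j'.+1 then g j' * rev_prod g j' else 1.

Definition braid_gens (H : pzRingType) (g : nat -> H) (m : nat) : Prop :=
  (forall i, (i.+1 < m)%N -> g i * g i.+1 * g i = g i.+1 * g i * g i.+1) /\
  (forall i j, (i.+1 < j < m)%N -> g i * g j = g j * g i).

Section BraidGens.
Variables (H : pzRingType) (g gI : nat -> H) (m : nat).
Hypothesis bg : braid_gens g m.

Lemma gen_prod_far k j : (k < j < m)%N ->
  g j * \prod_(i < k) g i = (\prod_(i < k) g i) * g j.
Proof.
move=> /andP[kj jm]; elim: k kj => [|k IH] kj; first by rewrite big_ord0 mulr1 mul1r.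
rewrite big_ord_recr /= mulrA IH ?(ltnW kj) // -!mulrA; congr (_ * _).
by rewrite (bg.2 k) ?kj.
Qed.

(** Only g_i and g_{i+1} in the word interact with g_{i+1}, by one braid relation; all others
    commute with the generator that passes them. *)
Lemma gen_prod_shift k i : (i.+1 < k <= m)%N ->
  g i.+1 * \prod_(j < k) g j = (\prod_(j < k) g j) * g i.
Proof.
move=> /andP[]; elim: k => // k IH; rewrite ltnS leq_eqVlt => /predU1P[<-|ik] km.
  rewrite !big_ord_recr /= !mulrA gen_prod_far ?leqnn //.
  by rewrite -!mulrA; congr (_ * _); rewrite !mulrA bg.1.
rewrite big_ord_recr /= mulrA IH ?(ltnW km) // -!mulrA; congr (_ * _).
by rewrite bg.2 // ik km.
Qed.

Hypotheses (ggI : forall i, (i < m)%N -> g i * gI i = 1)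
  (gIg : forall i, (i < m)%N -> gI i * g i = 1).

Lemma gen_prodV k : (k <= m)%N -> (\prod_(i < k) g i) * rev_prod gI k = 1.
Proof.
elim: k => [|k IH] km; first by rewrite big_ord0 mul1r.
rewrite big_ord_recr /= -mulrA [g k * _]mulrA ggI // mul1r; exact/IH/ltnW.
Qed.

Lemma gen_Vprod k : (k <= m)%N -> rev_prod gI k * (\prod_(i < k) g i) = 1.
Proof.
elim: k => [|k IH] km; first by rewrite big_ord0 mul1r.
rewrite big_ord_recr /= -mulrA [rev_prod _ _ * _]mulrA IH ?(ltnW km) // mul1r.
exact: gIg.
Qed.

End BraidGens.

Section Hecke.
Variables (K : fieldType) (q : K).
Hypotheses (q0 : q != 0) (q1 : forall n : int, n != 0 -> q ^ n != 1).
Variable d : nat.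
Local Notation H := 'M[K]_d.

(** The quadratic relation is (q - g_i)(q^(-1) + g_i) = 0 multiplied out. *)
Definition hecke_gens (g : nat -> H) (m : nat) : Prop :=
  (forall i, (i < m)%N -> g i * g i = (q - q^-1) *: g i + 1) /\
  braid_gens g m.

(* When [g i] is R_{i.+1}, [asym g k] is P^{(k.+1)}, and g 0, ..., g k.-1 occur in it. *)
Fixpoint asym (g : nat -> H) (k : nat) : H :=
  if k is k'.+1 then
    (qint q k'.+1 / qint q k'.+2) *:
      (asym g k' * ((q ^+ k'.+1 / qint q k'.+1)%:M - g k') * asym g k')
  else 1.

Lemma asymS g k : asym g k.+1 = (qint q k.+1 / qint q k.+2) *:
  (asym g k * ((q ^+ k.+1 / qint q k.+1)%:M - g k) * asym g k).
Proof. by []. Qed.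

(** Transposition reverses products and preserves the relations, so every left-handed statement
    about [asym] yields its right-handed mirror. *)
Lemma hecke_gens_tr g m : hecke_gens g m -> hecke_gens (fun i => (g i)^T) m.
Proof.
have trM (X Y : H) : X^T * Y^T = (Y * X)^T by rewrite [RHS]trmx_mul.
case=> sq [br far]; split=> [i im|]; last split=> [i im|i j ij].
- by rewrite trM sq // linearD linearZ /= trmx1.
- by rewrite !trM !mulrA br.
- by rewrite !trM (far i j).
Qed.

Lemma asym_tr g k : asym (fun i => (g i)^T) k = (asym g k)^T.
Proof.
elim: k => [|k IH] /=; first by rewrite trmx1.
rewrite IH linearZ /=; congr (_ *: _).
by rewrite ![in RHS]trmx_mul linearB /= tr_scalar_mx -mulrA.
Qed.

Section Gens.
Variable g : nat -> H.

Lemma asym_comm X k : (forall i, (i < k)%N -> GRing.comm X (g i)) ->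
  GRing.comm X (asym g k).
Proof.
elim: k => [|k IH] cX /=; first exact: commr1.
have cA : GRing.comm X (asym g k) by apply: IH => i ik; apply/cX/ltnW.
rewrite /GRing.comm mxZl mxZr; congr (_ *: _).
apply: commrM => //; apply: commrM => //; apply: commrB; last exact: cX.
by rewrite /GRing.comm mx_scalarl mx_scalarr.
Qed.

(** On such an X each middle factor acts as q^m/m_q + q^(-1) = (m+1)_q/m_q, which the normalization
    cancels. Taking X to be the antisymmetrizer gives its idempotence. *)
Lemma asym_absorbl X k : (forall i, (i < k)%N -> g i * X = (- q^-1) *: X) ->
  asym g k * X = X.
Proof.
elim: k => [|k IH] gX /=; first by rewrite mul1r.
have AX : asym g k * X = X by apply: IH => i ik; apply/gX/ltnW.
rewrite mxZl -[_ * _ * X]mulrA AX -[_ * _ * X]mulrA [(_ - g k) * X]mulrBl.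
rewrite gX // mx_scalarl -scalerBl mxZr AX scalerA.
rewrite [X in X *: _](_ : _ = 1) ?scale1r // opprK (qintSl q0 q1 k.+1).
have := qint_neq0 q0 q1 k.+1; rewrite (qintSl q0 q1 k.+1) => h.
move: (qint q k.+1) (qint_neq0 q0 q1 k) h => Q Q0 h; field.
rewrite q0 Q0 (_ : _ + Q = (q ^+ k.+1 + q^-1 * Q) * q) ?mulf_neq0 //.
by rewrite mulrDl mulrAC mulVf ?mul1r.
Qed.

End Gens.

Section Gens2.
Variables (g : nat -> H) (m : nat).
Hypothesis hg : hecke_gens g m.

(** Generators other than the last are absorbed by the outer left copy of the smaller
    antisymmetrizer. The last one needs the quadratic and braid relations. *)
Lemma asym_gl k i : (k <= m)%N -> (i < k)%N -> g i * asym g k = (- q^-1) *: asym g k.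
Proof.
have [sq [br far]] := hg.
elim: k i => // k IH i km; rewrite ltnS leq_eqVlt => /predU1P[->|ik]; last first.
  rewrite /= mxZr [g i * _]mulrA [g i * (_ * _)]mulrA IH ?(ltnW km) //.
  by rewrite !mxZl !scalerA [_ * - q^-1]mulrC.
case: k IH km => [|k] IH km.
  rewrite /= !(mulr1, mul1r) mxZr scalerA [- q^-1 * _]mulrC -[RHS]scalerA; congr (_ *: _).
  rewrite mulrBr sq // mx_scalarr qint1 // divr1 expr1.
  move: (g 0%N) => U; apply/matrixP => x y; rewrite !mxE; field; exact: q0.
rewrite asymS.
set B := asym g k.+1; set A := asym g k.
have gB j : (j < k.+1)%N -> g j * B = (- q^-1) *: B by apply: IH; apply: ltnW.
have BB : B * B = B by apply: asym_absorbl.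
have AB : A * B = B by apply: asym_absorbl => j jk; apply/gB/ltnW.
have cA : GRing.comm (g k.+1) A.
  by apply: asym_comm => j jk; rewrite /GRing.comm (far j) ?ltnS ?jk.
(* Only the left copy of B is expanded; the factors A then commute with g_{k+1} and disappear into
   the right copy of B. *)
have key : qint q k.+2 *: (B * g k.+1 * B) =
    q ^+ k.+1 *: (g k.+1 * B) - qint q k.+1 *: (A * g k * g k.+1 * B).
  rewrite {1}/B asymS -/A !mxZl scalerA mulrCA divff ?qint_neq0 // mulr1.
  rewrite mulrBr !mulrBl mx_scalarr !mxZl scalerBr scalerA.
  rewrite [qint q _ * _]mulrC divfK ?qint_neq0 //; congr (_ *: _ - _ *: _).
    by rewrite -!mulrA [A * (g _ * _)]mulrA -cA -mulrA AB mulrA -cA -mulrA AB.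
  by rewrite -!mulrA; congr (_ * (_ * _)); rewrite mulrA -cA -mulrA AB.
have n1 := qint_neq0 q0 q1 k.+1; clearbody A B.
set Z := B * (_ - _) * B.
have Zdef : qint q k.+2 *: Z =
  q ^+ k.+2 *: B - q ^+ k.+1 *: (g k.+1 * B) + qint q k.+1 *: (A * g k * g k.+1 * B).
  rewrite /Z mulrBr mulrBl scalerBr key mx_scalarr mxZl BB scalerA.
  by rewrite mulrC divfK // opprB addrA addrAC.
(* The braid relation turns g_{k+1} g_k g_{k+1} B into g_k g_{k+1} g_k B, where B absorbs g_k; the
   quadratic relation treats the term g_{k+1} B. *)
have gZ : g k.+1 * Z = (- q^-1) *: Z.
  apply: (scalerI n1); rewrite -mxZr [RHS]scalerA [qint q _ * - q^-1]mulrC.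
  rewrite -[RHS]scalerA Zdef.
  rewrite mulrDr mulrBr !mxZr mulrA sq // !mulrA cA -!mulrA.
  rewrite [g k.+1 * (g k * _)]mulrA [g k.+1 * g k * (g _ * _)]mulrA -br //.
  rewrite -!mulrA gB // !mxZr mulrDl mxZl mul1r.
  move: (A * _) => V; move: (g k.+1 * B) {gB BB AB key Z Zdef} (B) => U W.
  apply/matrixP => x y; rewrite !mxE !exprS; field; exact: q0.
by rewrite mxZr gZ !scalerA [_ * - q^-1]mulrC.
Qed.

End Gens2.

Section Gens3.
Variables (g : nat -> H) (m : nat).
Hypothesis hg : hecke_gens g m.
Local Notation a := (- q^-1).

Lemma asym_gr k i : (k <= m)%N -> (i < k)%N -> asym g k * g i = a *: asym g k.
Proof.
move=> km ik; have := asym_gl (hecke_gens_tr hg) km ik.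
rewrite asym_tr => /(congr1 trmx); rewrite linearZ /= trmxK => <-.
by rewrite trmx_mul !trmxK.
Qed.

Lemma asym_absorbr X k : (forall i, (i < k)%N -> X * g i = a *: X) ->
  X * asym g k = X.
Proof.
move=> Xg; apply: trmx_inj; rewrite trmx_mul -asym_tr; apply: asym_absorbl => // i ik.
by rewrite -[LHS]trmx_mul [X *m g i]Xg // linearZ.
Qed.

Arguments asym : simpl never.

(** The right-hand A in the expansion of the left copy of B commutes with the next middle factor and
    is absorbed by the right copy of B, so one antisymmetrizer survives. *)
Lemma prod_asym k : (k < m)%N ->
  asym g k.+1 = (\prod_(i < k.+1) (qint q i.+1 / qint q i.+2)) *:
    ((\prod_(i < k.+1) ((q ^+ i.+1 / qint q i.+1)%:M - g i)) * asym g k).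
Proof.
have [_ [_ far]] := hg.
elim: k => [|k IH] km; first by rewrite asymS mul1r !mulr1 !big_ord1.
have Ac := IH (ltnW km); rewrite asymS {1}Ac mxZl mxZl scalerA.
rewrite [\prod_(i < k.+2) (qint q _ / _)]big_ord_recr /= [X in X *: _ = _]mulrC.
congr (_ *: _).
set B := asym g k.+1; set A := asym g k.
have AB : A * B = B.
  by apply: asym_absorbl => // j jk; apply: (asym_gl hg); [apply: ltnW | apply: leqW].
rewrite [in RHS]big_ord_recr /= -[_ * A * _]mulrA.
have -> : A * ((q ^+ k.+2 / qint q k.+2)%:M - g k.+1) =
    ((q ^+ k.+2 / qint q k.+2)%:M - g k.+1) * A.
  symmetry; apply: asym_comm => j jk; apply/commr_sym/commrB.
    by rewrite /GRing.comm mx_scalarl mx_scalarr.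
  by rewrite /GRing.comm (far j) // ltnS jk.
rewrite -[LHS]mulrA -[RHS]mulrA; congr (_ * _); by rewrite -mulrA AB.
Qed.

Variable gI : nat -> H.
Hypotheses (ggI : forall i, (i < m)%N -> g i * gI i = 1)
  (gIg : forall i, (i < m)%N -> gI i * g i = 1).

Lemma gen_prod_absorb k j X : (j <= k)%N ->
  (forall i, (i < k)%N -> g i * X = a *: X) ->
  (\prod_(i < j) g i) * X = a ^+ j *: X.
Proof.
move=> jk gX; elim: j jk => [|j IH] jk; first by rewrite big_ord0 mul1r scale1r.
by rewrite big_ord_recr /= -mulrA gX // mxZr IH ?(ltnW jk) // scalerA -exprS.
Qed.

(* Up to the factor k.+2_q, the antisymmetrizer on the factors 1..k.+2 is the one
   on the factors 2..k.+2 times a signed sum over coset representatives. *)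
Lemma asym_cosets k : (k < m)%N ->
  qint q k.+2 *: asym g k.+1 =
  (\prod_(i < k.+1) g i) * asym g k * rev_prod gI k.+1 *
  \sum_(j < k.+2) ((-1) ^+ j * q ^+ (k.+1 - j)) *: \prod_(i < j) g i.
Proof.
move=> km; have [sq [br far]] := hg.
set w := \prod_(i < k.+1) g i; set wI := rev_prod _ _.
have wwI : w * wI = 1 by apply: (gen_prodV ggI).
have wIw : wI * w = 1 by apply: (gen_Vprod gIg).
set S := w * _ * wI; set W := \sum_(j < _) _.
(* Conjugation by w raises generator indices by one, so S inherits the antisymmetry of [asym g k]
   under the shifted generators. *)
have Sg i : (i < k)%N -> S * g i.+1 = a *: S.
  move=> ik; have gw : g i.+1 * w = w * g i.
    by apply: (gen_prod_shift hg.2); rewrite ltnS ik.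
  have wIg : wI * g i.+1 = g i * wI.
    by rewrite -[LHS]mulr1 -wwI -mulrA [g i.+1 * _]mulrA gw !mulrA wIw mul1r.
  rewrite /S -mulrA wIg mulrA -[w * _ * g i]mulrA asym_gr ?(ltnW km) //.
  by rewrite mxZr mxZl.
have gA i : (i < k.+1)%N -> g i * asym g k.+1 = a *: asym g k.+1.
  exact: (asym_gl hg).
have wA : w * asym g k.+1 = a ^+ k.+1 *: asym g k.+1.
  exact: (gen_prod_absorb (leqnn _) gA).
(* Up to the nonzero scalar a^(k+1), the antisymmetrizer equals w times itself, and w^(-1) in S
   cancels this w. *)
have SA : S * asym g k.+1 = asym g k.+1.
  have a0 : a ^+ k.+1 != 0 by rewrite expf_neq0 // oppr_eq0 invr_eq0.
  apply: (scalerI a0); rewrite -mxZr -wA /S -[LHS]mulrA [wI * _]mulrA wIw mul1r.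
  by rewrite -[LHS]mulrA asym_absorbl // => i ik; apply/gA/leqW.
have WA : W * asym g k.+1 = qint q k.+2 *: asym g k.+1.
  rewrite -(qint_sum q0 q1) mulr_suml scaler_suml; apply: eq_bigr => j _.
  by rewrite mxZl (gen_prod_absorb (leq_ord j) gA) scalerA.
have SWA : S * W * asym g k.+1 = qint q k.+2 *: asym g k.+1.
  by rewrite -mulrA WA mxZr SA.
rewrite -SWA; clearbody S; clear wA wwI wIw.
(* Terms j = i and j = i + 1 combine by the quadratic relation. For j < i the generator passes the
   word unchanged, for j > i + 1 it becomes g_{i+1}; either way S absorbs it. Hence S W equals its
   product with the larger antisymmetrizer. *)
have SW i : (i < k.+1)%N -> S * W * g i = a *: (S * W).
  move=> ik.
  pose t j := ((-1) ^+ j * q ^+ (k.+1 - j)) *: (S * (\prod_(l < j) g l)).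
  have tE : S * W = \sum_(j < k.+2) t j.
    by rewrite /W mulr_sumr; apply: eq_bigr => j _; rewrite mxZr.
  apply/eqP; rewrite -subr_eq0 tE mulr_suml scaler_sumr -sumrB.
  have lt1 : (i < k.+2)%N by apply: leqW.
  rewrite (bigD1 (Ordinal lt1)) //= (bigD1 (Ordinal (ik : (i.+1 < k.+2)%N))) /=;
    last by rewrite -val_eqE /= eqn_leq ltnn.
  rewrite big1 => [|j].
    rewrite addr0 /t !mxZl !scalerA subSS big_ord_recr /= -!(mulrA S).
    rewrite -[_ * g i * g i]mulrA.
    rewrite sq ?(leq_trans ik) // !mulrDr mulr1 !mxZr.
    rewrite subSn // !exprS; apply/eqP; move: (S * (_ * g i)) => U.
    move: (S * _) => V; apply/matrixP => x y; rewrite !mxE; field; exact: q0.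
  rewrite -!val_eqE /= => /andP[ji ji1].
  suff e : S * (\prod_(l < j) g l) * g i = a *: (S * \prod_(l < j) g l).
    by rewrite /t mxZl e !scalerA [a * _]mulrC subrr.
  have [ij|ij|e] := ltngtP j i; last by rewrite e eqxx in ji.
    rewrite -mulrA -(gen_prod_far hg.2) ?ij ?(leq_trans ik) // mulrA.
    by case: i ij ik {lt1 ji ji1} => // i _ ik; rewrite Sg // mxZl.
  rewrite -mulrA -(gen_prod_shift hg.2); last first.
    by rewrite ltn_neqAle eq_sym ji1 ij (leq_trans (leq_ord j)).
  rewrite mulrA Sg ?mxZl // -ltnS (leq_trans _ (leq_ord j)) //.
  by rewrite ltn_neqAle eq_sym ji1.
exact: asym_absorbr.
Qed.

End Gens3.
End Hecke.

(** * Ordered products of the copies of the generating matrix *)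

(** Conjugation by u of the relation r a b = a' b' r; it carries the Yangian relation from one pair
    of adjacent copies to the next. *)
Lemma intertwine_conj (H : pzRingType) (u v r r' a a' A A' b b' B B' : H) :
  u * v = 1 -> u * r = r' * u -> u * a = A * u -> u * b = B * u ->
  u * a' = A' * u -> u * b' = B' * u ->
  r * a * b = a' * b' * r -> r' * A * B = A' * B' * r'.
Proof.
move=> uv ur ua ub ua' ub' e; rewrite -[LHS]mulr1 -[RHS]mulr1 -uv !mulrA.
congr (_ * _); rewrite -(mulrA _ B u) -ub mulrA -(mulrA r' A u) -ua mulrA -ur.
rewrite -(mulrA _ r' u) -ur mulrA -(mulrA A' B' u) -ub' mulrA -ua'.
by rewrite -!mulrA; congr (_ * _); rewrite !mulrA.
Qed.

Lemma intertwine_step (H : pzRingType) (P r D a a' b b' E : H) :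
  r * D = D * r -> r * a * b = a' * b' * r -> P * D * a' = E * P ->
  b' * P = P * b' -> P * r * (D * a) * b = E * b' * (P * r).
Proof.
move=> rD rab PDa bP; rewrite mulrA -(mulrA P) rD mulrA -!mulrA [r * _]mulrA rab.
by rewrite !mulrA PDa -(mulrA E P) -bP !mulrA.
Qed.

Section Copies.
Variables (H : pzRingType) (g gI : nat -> H) (m : nat) (x : nat -> H).
Hypothesis bg : braid_gens g m.
Hypotheses (ggI : forall i, (i < m)%N -> g i * gI i = 1)
  (gIg : forall i, (i < m)%N -> gI i * g i = 1).
Hypothesis x_far : forall i j, (0 < j < m)%N -> g j * x i = x i * g j.

(* [barred k i] is L_{\bar k.+1}(q^{-2i}u) when [x i] is L_1(q^{-2i}u). *)
Fixpoint barred (k i : nat) : H :=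
  if k is k'.+1 then g k' * barred k' i * gI k' else x i.

Arguments barred : simpl never.

Lemma comm_genV X k : (k < m)%N -> GRing.comm X (g k) -> GRing.comm X (gI k).
Proof.
move=> km cX; rewrite /GRing.comm -[RHS]mulr1 -(ggI km) mulrA -[gI k * X * g k]mulrA cX.
by rewrite mulrA gIg // mul1r.
Qed.

Lemma barredS k i : (k < m)%N -> g k * barred k i = barred k.+1 i * g k.
Proof. by move=> km; rewrite [barred k.+1 i]/(_ * _) -[RHS]mulrA gIg // mulr1. Qed.

Lemma barred_far_hi j k i : (k < j < m)%N -> GRing.comm (g j) (barred k i).
Proof.
move=> /andP[]; elim: k => [|k IH] kj jm; first by apply: x_far; rewrite kj.
have km : (k < m)%N by apply: ltn_trans jm; apply: ltnW.
have cg : GRing.comm (g j) (g k) by rewrite /GRing.comm (bg.2 k) ?kj.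
by apply: commrM; [apply: commrM => //; apply: IH => //; apply: ltnW | apply: comm_genV].
Qed.

(** In the base case k = j + 2 the copy is a conjugate of [barred j i] by u = g_{j+1} g_j. Since g_j
    u = u g_{j+1}, the claim becomes that g_{j+1} commutes with [barred j i]. *)
Lemma barred_far_lo j k i : (j.+1 < k <= m)%N -> GRing.comm (g j) (barred k i).
Proof.
move=> /andP[]; elim: k => // k IH; rewrite ltnS leq_eqVlt => /predU1P[<-|jk] km.
  have jm : (j < m)%N by apply: ltnW.
  set u := g j.+1 * g j; set v := gI j * gI j.+1.
  have uv : u * v = 1 by rewrite /u /v -mulrA [g j * _]mulrA ggI // mul1r ggI.
  have vu : v * u = 1 by rewrite /u /v -mulrA [gI j.+1 * _]mulrA gIg // mul1r gIg.
  have gu : g j * u = u * g j.+1 by rewrite /u mulrA bg.1.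
  have gv : g j.+1 * v = v * g j.
    by rewrite -[LHS]mul1r -vu -mulrA [u * _]mulrA -gu -[g j * u * v]mulrA uv mulr1.
  have -> : barred j.+2 i = u * barred j i * v by rewrite /barred -/barred /u /v !mulrA.
  clearbody u v; rewrite /GRing.comm 2!mulrA gu -(mulrA u) barred_far_hi ?leqnn //.
  by rewrite -!mulrA gv.
have kg : GRing.comm (g j) (g k) by rewrite /GRing.comm bg.2 ?jk.
by apply: commrM; [apply: commrM => //; apply: IH => //; apply: ltnW | apply: comm_genV].
Qed.

(** Generators beyond g_j commute with the copy, g_j raises its index, and those before g_j commute
    with the raised copy. *)
Lemma barred_shift k j i : (j < k <= m)%N ->
  (\prod_(l < k) g l) * barred j i = barred j.+1 i * \prod_(l < k) g l.
Proof.
move=> /andP[]; elim: k => // k IH; rewrite ltnS leq_eqVlt => /predU1P[<-|jk] km.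
  have c : GRing.comm (barred j.+1 i) (\prod_(l < j) g l).
    apply: commr_prod => l _; apply/commr_sym/barred_far_lo.
    by rewrite ltnS ltn_ord.
  by rewrite big_ord_recr -[LHS]mulrA [X in _ * X]barredS // mulrA -c -mulrA.
rewrite big_ord_recr -[LHS]mulrA [X in _ * X]barred_far_hi ?jk //.
by rewrite mulrA IH ?(ltnW km) // mulrA.
Qed.

(* [C r] stands for the scalar operator q^r/r_q. *)
Variable C : nat -> H.
Hypothesis C_central : forall r X, GRing.comm X (C r).
Hypothesis x_rel : (0 < m)%N -> forall i r, (0 < r)%N ->
  (C r - g 0%N) * x i * g 0%N * x (i + r)%N =
  x (i + r)%N * g 0%N * x i * (C r - g 0%N).

(** Conjugation by g_k g_{k+1} raises every index in the relation by one, which gives the induction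
    step. *)
Lemma barred_rel k i r : (k < m)%N -> (0 < r)%N ->
  (C r - g k) * barred k i * barred k.+1 (i + r) =
  barred k (i + r) * barred k.+1 i * (C r - g k).
Proof.
elim: k => [|k IH] km r0.
  rewrite /= !mulrA x_rel // -!mulrA; congr (_ * (_ * (_ * _))).
  by apply/comm_genV/commr_sym/commrB => //; apply: C_central.
have km' := ltnW km; set u := g k * g k.+1.
have uV : u * (gI k.+1 * gI k) = 1.
  by rewrite /u -mulrA [g k.+1 * _]mulrA ggI // mul1r ggI.
have ug : u * (C r - g k) = (C r - g k.+1) * u.
  by rewrite mulrBr mulrBl (C_central r u); congr (_ - _); rewrite /u bg.1 ?mulrA.
have ul j : u * barred k j = barred k.+1 j * u.
  by rewrite /u -mulrA barred_far_hi ?ltnSn // mulrA barredS // mulrA.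
have uh j : u * barred k.+1 j = barred k.+2 j * u.
  by rewrite /u -mulrA barredS // mulrA barred_far_lo ?ltnSn // mulrA.
exact: (intertwine_conj uV ug (ul _) (uh _) (ul _) (uh _) (IH km' r0)).
Qed.

(** There are k + 1 copies, with arguments q^{-2(s+k)}u, ..., q^{-2s}u. The offset s is there
    because dropping the last copy leaves a product ending at s + 1. *)
Definition dec_prod s k := \prod_(j < k.+1) barred j (s + (k - j)).
Definition inc_prod s k := \prod_(j < k.+1) barred j (s + j).

Lemma dec_prodSr s k : dec_prod s k.+1 = dec_prod s.+1 k * barred k.+1 s.
Proof.
rewrite /dec_prod big_ord_recr /= subnn addn0; congr (_ * _).
by apply: eq_bigr => j _; rewrite subSn ?leq_ord // addnS.
Qed.

Lemma inc_prodSr s k : inc_prod s k.+1 = inc_prod s k * barred k.+1 (s + k.+1).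
Proof. by rewrite /inc_prod big_ord_recr. Qed.

(** As the word moves left, [barred_shift] lowers the index of every copy except the first, which
    stays in front. *)
Lemma dec_prodSl s k : (k < m)%N ->
  dec_prod s k.+1 * (\prod_(l < k.+1) g l) =
  x (s + k.+1) * (\prod_(l < k.+1) g l) * dec_prod s k.
Proof.
move=> km; have shift j i := @barred_shift k.+1 j i.
set w := \prod_(l < k.+1) g l in shift *.
rewrite /dec_prod big_ord_recl /= subn0 -!mulrA; congr (_ * _).
have aux j : (j <= k.+1)%N ->
    (\prod_(i < j) barred (bump 0 i) (s + (k.+1 - bump 0 i))) * w =
    w * \prod_(i < j) barred i (s + (k - i)).
  elim: j => [|j IH] jk; first by rewrite !big_ord0 mul1r mulr1.
  rewrite !big_ord_recr mulrA -IH ?(ltnW jk) // -[LHS]mulrA -[RHS]mulrA.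
  congr (_ * _).
  by rewrite /bump /= add1n subSS shift ?jk.
exact: aux.
Qed.

Lemma dec_prod_far s k j : (k < j < m)%N -> GRing.comm (g j) (dec_prod s k).
Proof.
move=> /andP[kj jm]; apply: commr_prod => i _; apply: barred_far_hi.
by rewrite jm (leq_ltn_trans (leq_ord i)).
Qed.

(** The argument with index s + k + 1 travels from the last copy to the first by adjacent exchanges.
    When it meets g_i the two argument indices differ by i + 1, hence the constant [C i.+1]. *)
Lemma prod_rho_dec s k : (k < m)%N ->
  (\prod_(i < k.+1) (C i.+1 - g i)) * dec_prod s k * barred k.+1 (s + k.+1) =
  dec_prod s k.+1 * \prod_(i < k.+1) (C i.+1 - g i).
Proof.
elim: k s => [|k IH] s km.
  by rewrite dec_prodSr /dec_prod !big_ord1 /= !addn0 barred_rel ?addn1.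
rewrite [in LHS]big_ord_recr [in RHS]big_ord_recr [in LHS]dec_prodSr dec_prodSr.
have rD : (C k.+2 - g k.+1) * dec_prod s.+1 k = dec_prod s.+1 k * (C k.+2 - g k.+1).
  symmetry; apply: commrB; first exact: C_central.
  by apply/commr_sym/dec_prod_far; rewrite ltnSn.
have cR : barred k.+2 s * \prod_(i < k.+1) (C i.+1 - g i) =
    \prod_(i < k.+1) (C i.+1 - g i) * barred k.+2 s.
  apply: commr_prod => i _; apply: commrB; first exact: C_central.
  by apply/commr_sym/barred_far_lo; rewrite ltnS ltn_ord.
have := IH s.+1 (ltnW km); rewrite addSnnS => E.
exact: (intertwine_step rD (barred_rel _ km (ltn0Sn _)) E cR).
Qed.

(** [P k] stands for P^{(k+1)}, and [D k] for the scalar in its factorization [prod_asym]. *)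
Variables (P : nat -> H) (D : nat -> H).
Hypothesis D_central : forall r X, GRing.comm X (D r).
Hypothesis P0 : P 0%N = 1.
Hypothesis PS : forall k, (k < m)%N ->
  P k.+1 = D k * (\prod_(i < k.+1) (C i.+1 - g i)) * P k.
Hypothesis P_comm : forall k X, (forall i, (i < k)%N -> GRing.comm X (g i)) ->
  GRing.comm X (P k).

(** The factor [P k] reverses the first k + 1 arguments and commutes with the last copy; the product
    of the exchange factors then brings the last argument to the front. *)
Lemma antisym_inc_prod k : (k <= m)%N -> P k * inc_prod 0 k = dec_prod 0 k * P k.
Proof.
elim: k => [|k IH] km.
  by rewrite P0 mulr1 mul1r /inc_prod /dec_prod !big_ord1.
rewrite PS // inc_prodSr.
have cP : barred k.+1 (0 + k.+1) * P k = P k * barred k.+1 (0 + k.+1).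
  apply: P_comm => i ik; apply/commr_sym/barred_far_lo; by rewrite ltnS ik.
rewrite -mulrA [P k * _]mulrA IH ?(ltnW km) // -(mulrA _ (P k)) -cP.
have := prod_rho_dec 0 km; have := D_central k (dec_prod 0 k.+1).
move: (barred _ _) (dec_prod 0 k) (dec_prod 0 k.+1) (D k) (P k) (\prod_(i < _) _).
by move=> c d d' D' p R dD e; rewrite !mulrA dD -(mulrA D' d') -e !mulrA.
Qed.

End Copies.

(** * The braided Yangian *)

Section Lift.
Variables (K : fieldType) (B : algType K).

Lemma in_alg_liftmx m n (X : 'M[K]_(m, n)) : liftmx B X = map_mx (in_alg B) X.
Proof. by []. Qed.

Lemma liftmx_is_zmod_morphism m n : zmod_morphism (@liftmx K B m n).
Proof. by move=> X Y; rewrite !in_alg_liftmx map_mxB. Qed.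

Lemma liftmx_is_monoid_morphism d :
  monoid_morphism (@liftmx K B d d : 'M[K]_d -> 'M[B]_d).
Proof.
by split=> [|X Y]; rewrite !in_alg_liftmx; [exact: map_mx1 | exact: map_mxM].
Qed.

HB.instance Definition _ m n := GRing.isZmodMorphism.Build 'M[K]_(m, n) 'M[B]_(m, n)
  (@liftmx K B m n) (@liftmx_is_zmod_morphism m n).
HB.instance Definition _ d := GRing.isMonoidMorphism.Build 'M[K]_d 'M[B]_d
  (@liftmx K B d d) (@liftmx_is_monoid_morphism d).

Lemma liftmxM d (X Y : 'M[K]_d) : liftmx B (X * Y) = liftmx B X * liftmx B Y.
Proof. exact: rmorphM. Qed.

Lemma liftmx1 d : liftmx B (1 : 'M[K]_d) = 1.
Proof. exact: rmorph1. Qed.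

Lemma liftmxB m n (X Y : 'M[K]_(m, n)) : liftmx B (X - Y) = liftmx B X - liftmx B Y.
Proof. exact: raddfB. Qed.

Lemma liftmxZ m n (c : K) (X : 'M[K]_(m, n)) : liftmx B (c *: X) = c%:A *: liftmx B X.
Proof. by rewrite !in_alg_liftmx map_mxZ. Qed.

Lemma liftmx_scalar_comm d (c : K) (X : 'M[B]_d) : GRing.comm X (liftmx B c%:M).
Proof.
rewrite /GRing.comm in_alg_liftmx map_scalar_mx; apply/matrixP => i j.
rewrite [X * _]/(X *m _) [_ * X]/(_ *m X) !mxE (bigD1 j) //= big1 => [|k kj].
  rewrite [RHS](bigD1 i) //= big1 => [|k ki].
    by rewrite !mxE !eqxx !addr0 !mulr1n mulr_algr mulr_algl.
  by rewrite !mxE eq_sym (negbTE ki) mulr0n mul0r.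
by rewrite !mxE (negbTE kj) mulr0n mulr0.
Qed.

Lemma mx_algZl d (c : K) (X Y : 'M[B]_d) : c%:A *: X * Y = c%:A *: (X * Y).
Proof. by symmetry; apply: scalemxAl. Qed.

Lemma mx_algZr m n p (c : K) (X : 'M[B]_(m, n)) (Y : 'M[B]_(n, p)) :
  X *m (c%:A *: Y) = c%:A *: (X *m Y).
Proof.
apply/matrixP => i j; rewrite !mxE mulr_sumr; apply: eq_bigr => k _.
by rewrite !mxE mulr_algl -scalerAr mulr_algl.
Qed.

Lemma mulr_mx_algZ d (c : K) (X Y : 'M[B]_d) : X * (c%:A *: Y) = c%:A *: (X * Y).
Proof. exact: mx_algZr. Qed.

Lemma algZI m n (c : K) (X Y : 'M[B]_(m, n)) :
  c != 0 -> c%:A *: X = c%:A *: Y -> X = Y.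
Proof.
move=> c0 /(congr1 ( *:%R c^-1%:A)).
by rewrite !scalerA mulr_algl scalerA mulVf // !scale1r.
Qed.

Lemma liftmx_central m n (X : 'M[K]_(m, n)) a i j :
  a * liftmx B X i j = liftmx B X i j * a.
Proof. by rewrite mxE mulr_algr mulr_algl. Qed.

Variable N : nat.
Local Notation mindex n := {ffun 'I_n -> 'I_N}.

Lemma liftmx_emb n (X : 'M[K]_#|{: mindex n}|) : liftmx B (emb X) = emb (liftmx B X).
Proof.
by apply: embE => s t i j; rewrite !ent_liftmx ent_emb scalerMnl.
Qed.

Lemma liftmx_act_at n k (X : 'M[K]_(N * N)) :
  liftmx B (act_at n k X) = act_at n k (liftmx B X).
Proof.
by apply/matrixP => a b; rewrite !mxE /= /entry2 mxE scalerMnl.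
Qed.

End Lift.

HB.instance Definition _ N (A : nzRingType) n := GRing.isMonoidMorphism.Build
  'M[A]_#|{: {ffun 'I_n -> 'I_N}}| 'M[A]_#|{: {ffun 'I_n.+1 -> 'I_N}}|
  (@emb N A n) (conj (@emb1 N A n) (@embM N A n)).

(** * Words in the generators under ring morphisms *)

Section Morphism.
Variables (H H' : pzRingType) (f : {rmorphism H -> H'}).
Variables (g gI x : nat -> H) (g' gI' x' : nat -> H') (k : nat).
Hypotheses (fg : forall i, (i < k)%N -> f (g i) = g' i)
  (fgI : forall i, (i < k)%N -> f (gI i) = gI' i) (fx : forall i, f (x i) = x' i).

Lemma rmorph_barred j i : (j <= k)%N -> f (barred g gI x j i) = barred g' gI' x' j i.
Proof.
elim: j => [|j IH] jk; first exact: fx.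
by rewrite /barred -/barred !rmorphM fg // fgI // IH // ltnW.
Qed.

Lemma rmorph_dec_prod s j : (j <= k)%N ->
  f (dec_prod g gI x s j) = dec_prod g' gI' x' s j.
Proof.
move=> jk; rewrite rmorph_prod; apply: eq_bigr => i _.
by rewrite rmorph_barred // (leq_trans (leq_ord i)).
Qed.

Lemma rmorph_rev_prod j : (j <= k)%N -> f (rev_prod gI j) = rev_prod gI' j.
Proof.
elim: j => [|j IH] jk /=; first by rewrite rmorph1.
by rewrite rmorphM fgI // IH // ltnW.
Qed.

Lemma rmorph_gen_prod j : (j <= k)%N ->
  f (\prod_(i < j) g i) = \prod_(i < j) g' i.
Proof.
move=> jk; rewrite rmorph_prod; apply: eq_bigr => i _.
by rewrite fg // (leq_trans (ltn_ord i)).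
Qed.
End Morphism.

Lemma rmorph_asym (K : fieldType) (q : K) d d' (f : {rmorphism 'M[K]_d -> 'M[K]_d'})
    g g' k : (forall c X, f (c *: X) = c *: f X) ->
  (forall i, (i < k)%N -> f (g i) = g' i) ->
  f (asym q g k) = asym q g' k.
Proof.
move=> fZ; elim: k => [|k IH] fg; first by rewrite rmorph1.
rewrite !asymS fZ rmorphM (rmorphM f) rmorphB fg // IH => [|i ik]; last exact/fg/ltnW.
by rewrite -[(_ / _)%:M]scalemx1 fZ -[1%:M]/1 rmorph1 -scalemx1.
Qed.

(** * The operators R_i as Hecke generators *)

Section Gens.
Variables (N : nat) (K : fieldType) (q : K) (R : 'M[K]_(N * N)).
Hypothesis q0 : q != 0.
Hypothesis R_hecke : hecke_symmetry q R.
Local Notation mindex n := {ffun 'I_n -> 'I_N}.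

Definition gen n i := act_at n i.+1 R.
Definition genV n i := act_at n i.+1 (invmx R).

Lemma hecke_sqr : R *m R = (q - q^-1) *: R + 1%:M.
Proof.
have := R_hecke.2; rewrite mulmxBl !mulmxDr -scalar_mxM divff // mul_scalar_mx.
rewrite mul_mx_scalar => /eqP; rewrite subr_eq0 => /eqP e.
by rewrite scalerBl addrAC [_ *: R + _]addrC e addrAC subrr add0r.
Qed.

Lemma hecke_unitmx : R \in unitmx.
Proof.
have : R *m (R - (q - q^-1)%:M) = 1%:M.
  by rewrite mulmxBr hecke_sqr mul_mx_scalar addrAC subrr add0r.
by case/mulmx1_unit.
Qed.

Lemma hecke_gens_act_at n : hecke_gens q (gen n) n.
Proof.
split=> [i im|]; last split=> [i im|i j /andP[ij jm]].
- by rewrite -act_atM ?im // hecke_sqr act_atD act_atZ act_at1 ?im.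
- by rewrite act_at_braid //; apply: R_hecke.1.
- by apply: act_at_far => //; [move=> a k l; rewrite mulrC | rewrite ltnS ij].
Qed.

Lemma act_at_invr n i : (i < n)%N -> gen n i * genV n i = 1.
Proof. by move=> im; rewrite -act_atM // mulmxV ?hecke_unitmx // act_at1. Qed.

Lemma act_at_invl n i : (i < n)%N -> genV n i * gen n i = 1.
Proof. by move=> im; rewrite -act_atM // mulVmx ?hecke_unitmx // act_at1. Qed.

Lemma skew_symmetrizerE n k : skew_symmetrizer q R n k.+1 = asym q (gen n) k.
Proof. by elim: k => [|k IH] //; rewrite asymS -IH. Qed.

Lemma asym_emb n k : (k <= n)%N -> asym q (gen n.+1) k = emb (asym q (gen n) k).
Proof.
move=> kn; symmetry; apply: rmorph_asym => [c shift_op|i ik].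
  by symmetry; apply: embE => s t i j; rewrite !entZ ent_emb mulrnAr.
by rewrite /gen act_at_emb // (leq_trans ik).
Qed.

End Gens.

(** * Recursion for the skew-symmetric powers *)

Section Yang.
Variables (N : nat) (K : fieldType) (q : K) (R Psi : 'M[K]_(N * N)).
Hypothesis q0 : q != 0.
Hypothesis q1 : forall n : int, n != 0 -> q ^ n != 1.
Hypothesis R_hecke : hecke_symmetry q R.
Hypothesis R_skew_inv : skew_inverse R Psi.
Variables (A : algType K) (L : 'M[fps A]_N).
Hypothesis L_yang : yang_defect q R L = 0.
Local Notation mindex n := {ffun 'I_n -> 'I_N}.
Local Notation B := (fps A).
Definition gen_op n i := liftmx B (gen R n i).
Definition genV_op n i := liftmx B (genV R n i).
Definition shift_mx i := dilate_mx (q ^- (2 * i)) L.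
Definition shift_op n i := act1 (ord0 : 'I_n.+1) (shift_mx i).
Local Notation a := (- q^-1).

Lemma gen_op_braid n : braid_gens (gen_op n) n.
Proof.
have [_ [br far]] := hecke_gens_act_at q0 R_hecke n.
by split=> [i im|i j ij];
  [have := congr1 (@liftmx K B _ _) (br i im)
  | have := congr1 (@liftmx K B _ _) (far i j ij)];
  rewrite !liftmxM.
Qed.

Lemma gen_opV n i : (i < n)%N -> gen_op n i * genV_op n i = 1.
Proof. by move=> im; rewrite -liftmxM (act_at_invr q0) // liftmx1. Qed.

Lemma genV_opK n i : (i < n)%N -> genV_op n i * gen_op n i = 1.
Proof. by move=> im; rewrite -liftmxM (act_at_invl q0) // liftmx1. Qed.

Lemma shift_op_far n i j : (0 < j < n)%N ->
  gen_op n j * shift_op n i = shift_op n i * gen_op n j.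
Proof.
move=> jm; rewrite /gen_op /gen liftmx_act_at; symmetry; apply: act1_far jm.
exact: liftmx_central.
Qed.

Lemma emb_gen_op n i : (i < n)%N -> emb (gen_op n i) = gen_op n.+1 i.
Proof. by move=> im; rewrite -liftmx_emb -act_at_emb. Qed.

Lemma emb_genV_op n i : (i < n)%N -> emb (genV_op n i) = genV_op n.+1 i.
Proof. by move=> im; rewrite -liftmx_emb -act_at_emb. Qed.

Lemma emb_shift_op n i : emb (shift_op n i) = shift_op n.+1 i.
Proof. by rewrite /shift_op act1_emb. Qed.

Lemma dilate_mxD c i j : dilate_mx (q ^- (2 * i)) (dilate_mx (q ^- (2 * j)) c) =
  dilate_mx (q ^- (2 * (i + j))) c :> 'M[B]_N.
Proof.
apply/matrixP => k l; rewrite !mxE; apply: fpsP => r /=.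
by rewrite scalerA -invfM -exprMn -invfM -exprD mulnDr.
Qed.

Lemma dilate_mx0 (Y : 'M[B]_N) : dilate_mx (q ^- (2 * 0)) Y = Y.
Proof.
apply/matrixP => k l; rewrite !mxE; apply: fpsP => r /=.
by rewrite expr0 invr1 expr1n invr1 scale1r.
Qed.

Definition scal_op n r : 'M[B]_#|{: mindex n.+1}| := liftmx B (q ^+ r / qint q r)%:M.

(** At v = q^{-2r}u the operator X of [yang_defect_specialize] is a multiple of q^r/r_q - R_1, with
    factor 1 - q^{2r}, which is nonzero for generic q. *)
Lemma shift_op_rel n : (0 < n)%N -> forall i r, (0 < r)%N ->
  (scal_op n r - gen_op n 0) * shift_op n i * gen_op n 0 * shift_op n (i + r) =
  shift_op n (i + r) * gen_op n 0 * shift_op n i * (scal_op n r - gen_op n 0).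
Proof.
move=> n0 i; case=> // r _; elim: n n0 => // -[|n] IH _; last first.
  (* All operators involved act in the first two factors, so more factors reduce to two. *)
  have E : scal_op n.+2 r.+1 = emb (scal_op n.+1 r.+1).
    by rewrite /scal_op -liftmx_emb emb_scalar.
  rewrite E -emb_gen_op // -!(emb_shift_op n.+1) -emb_is_zmod_morphism -!embM.
  by congr emb; apply: IH.
have c0 : q ^- (2 * r.+1) != 0 by rewrite invr_eq0 expf_neq0.
have Y := yang_defect_specialize (q ^- (2 * r.+1)) L_yang; cbv zeta in Y; move: Y.
set s := (q ^- (2 * r.+1))^-1 - 1.
have s0 : s != 0.
  rewrite /s invrK subr_eq0 -[_ ^+ _]/(q ^ Posz (2 * r.+1)); exact: q1.
have -> : s *: act_at 1 1 R - ((q - q^-1) / q ^- (2 * r.+1))%:M =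
    (- s) *: ((q ^+ r.+1 / qint q r.+1)%:M - act_at 1 1 R).
  rewrite scalerBr !scaleNr opprK addrC; congr (_ + _).
  apply/matrixP => u v; rewrite !mxE mulrnAr; congr (- (_ *+ _)).
  have qr0 : q ^+ r.+1 != 0 by rewrite expf_neq0.
  have qq : q ^+ r.+1 - q ^- r.+1 != 0.
    have := qint_neq0 q0 q1 r; rewrite /qint mulf_eq0 negb_or.
    by case/andP.
  have hq := q_sub_inv_neq0 q0 q1.
  rewrite /s /qint mulnC exprM; move: (q ^+ r.+1) qr0 qq => Q qr0 qq.
  field; rewrite q0 qr0 oner_eq0 /=; apply/andP; split.
    by rewrite -(mulVf q0) -mulrBl mulf_neq0.
  by rewrite andbT -(mulVf qr0) -mulrBl mulf_neq0.
(* The substitution of q^{-2i}u for u passes from the pair of indices 0, r to the pair i, i + r. *)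
move=> e; pose F : {rmorphism B -> B} := @fps_dilate K A (q ^- (2 * i)).
have FA c : F c%:A = c%:A by exact: fps_dilate_alg.
have := congr1 (map_mx F) e.
rewrite !map_mxM !(map_act1 F) !(map_liftmx FA).
rewrite (_ : map_mx F L = shift_mx i) //.
rewrite (_ : map_mx F _ = shift_mx (i + r.+1)); last exact: dilate_mxD.
rewrite liftmxZ -!scalemxAl mx_algZr => /algZI h.
rewrite /scal_op /gen_op /gen -liftmxB; apply: h; by rewrite oppr_eq0.
Qed.

Local Notation dec n := (dec_prod (gen_op n) (genV_op n) (shift_op n)).
Definition antisym n k : 'M[B]_#|{: mindex n.+1}| := liftmx B (asym q (gen R n) k).

Lemma LbarE n k i :
  Lbar R n k.+1 (shift_mx i) = barred (gen_op n) (genV_op n) (shift_op n) k i.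
Proof.
elim: k => [|k IH] //.
by transitivity (gen_op n k * Lbar R n k.+1 (shift_mx i) * genV_op n k);
  [by [] | rewrite IH].
Qed.

Lemma antisym_comm n k Y : (forall i, (i < k)%N -> GRing.comm Y (gen_op n i)) ->
  GRing.comm Y (antisym n k).
Proof.
elim: k => [|k IH] cY; first by rewrite /antisym liftmx1; apply: commr1.
have cP : GRing.comm Y (antisym n k) by apply: IH => i ik; apply/cY/ltnW.
rewrite /antisym asymS -mx_scalarl !liftmxM liftmxB.
apply: commrM; first exact: liftmx_scalar_comm.
apply: commrM => //; apply: commrM => //; apply: commrB; last exact: cY.
exact: liftmx_scalar_comm.
Qed.

Lemma skew_productE n : skew_product q R n L = dec n 0 n * antisym n n.
Proof.
rewrite -(@antisym_inc_prod _ (gen_op n) (genV_op n) n (shift_op n)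
  (gen_op_braid n) (@gen_opV n) (@genV_opK n)
  (@shift_op_far n) (scal_op n) _ (@shift_op_rel n) (antisym n)
  (fun k => liftmx B (\prod_(i < k.+1) (qint q i.+1 / qint q i.+2))%:M)) //.
- rewrite /skew_product skew_symmetrizerE big_add1 big_mkord; congr (_ * _).
  by apply: eq_bigr => j _; rewrite subSS subn0 LbarE.
- by move=> r Y; apply: liftmx_scalar_comm.
- by move=> r Y; apply: liftmx_scalar_comm.
- exact: liftmx1.
- move=> k kn; rewrite /antisym (prod_asym q0 q1 (hecke_gens_act_at q0 R_hecke n)) //.
  rewrite -mx_scalarl !liftmxM mulrA; congr (_ * _ * _).
  rewrite [LHS](big_morph (@liftmx K B _ _) (@liftmxM K B _) (liftmx1 _ _)).
  by apply: eq_bigr => i _; rewrite liftmxB.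
- exact: antisym_comm.
Qed.

Lemma dec_emb n s k : (k <= n)%N -> dec n.+1 s k = emb (dec n s k).
Proof.
move=> kn; symmetry; apply: (@rmorph_dec_prod _ _ (@emb N B n.+1) _ _ _ _ _ _ k) => // i.
- by move=> ik; apply: emb_gen_op; apply: leq_trans kn.
- by move=> ik; apply: emb_genV_op; apply: leq_trans kn.
- exact: emb_shift_op.
Qed.

Lemma antisym_emb n k : (k <= n)%N -> antisym n.+1 k = emb (antisym n k).
Proof. by move=> kn; rewrite /antisym asym_emb // liftmx_emb. Qed.

Definition gen_word n j := \prod_(i < j) gen_op n i.

Lemma gen_wordS n j : gen_word n j.+1 = gen_word n j * gen_op n j.
Proof. by rewrite /gen_word big_ord_recr. Qed.

Lemma gen_word_emb n j : (j <= n)%N -> gen_word n.+1 j = emb (gen_word n j).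
Proof.
move=> jn; symmetry; apply: (@rmorph_gen_prod _ _ (@emb N B n.+1) _ _ j) => // i ij.
by apply: emb_gen_op; apply: leq_trans jn.
Qed.

Lemma rev_genV_emb n j : (j <= n)%N ->
  rev_prod (genV_op n.+1) j = emb (rev_prod (genV_op n) j).
Proof.
move=> jn; symmetry; apply: (@rmorph_rev_prod _ _ (@emb N B n.+1) _ _ j) => // i ij.
by apply: emb_genV_op; apply: leq_trans jn.
Qed.

Lemma rev_gen_emb n j : (j <= n)%N ->
  rev_prod (gen_op n.+1) j = emb (rev_prod (gen_op n) j).
Proof.
move=> jn; symmetry; apply: (@rmorph_rev_prod _ _ (@emb N B n.+1) _ _ j) => // i ij.
by apply: emb_gen_op; apply: leq_trans jn.
Qed.

Lemma antisym_cosets n : (qint q n.+2)%:A *: antisym n.+1 n.+1 =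
  gen_word n.+1 n.+1 * antisym n.+1 n * rev_prod (genV_op n.+1) n.+1 *
  \sum_(j < n.+2) ((-1) ^+ j * q ^+ (n.+1 - j))%:A *: gen_word n.+1 j.
Proof.
have lw j : liftmx B (\prod_(i < j) gen R n.+1 i) = gen_word n.+1 j.
  by apply: (@rmorph_gen_prod _ _ (@liftmx K B _ _) _ _ j).
rewrite /antisym -liftmxZ (asym_cosets q0 q1 (hecke_gens_act_at q0 R_hecke n.+1)
  (@act_at_invr _ _ _ _ q0 R_hecke n.+1) (@act_at_invl _ _ _ _ q0 R_hecke n.+1)) //.
rewrite 3!liftmxM lw; congr (_ * _ * _ * _).
  by apply: (@rmorph_rev_prod _ _ (@liftmx K B _ _) _ _ n.+1).
rewrite raddf_sum; apply: eq_bigr => j _.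
by rewrite [LHS]liftmxZ lw.
Qed.

Lemma mulr_dec_assoc (H : pzRingType) (d v x e p r S : H) : d * v = x * v * e ->
  d * (v * p * r * S) = x * (v * (e * p) * (r * S)).
Proof. by move=> dv; rewrite !mulrA dv. Qed.

Local Notation Rtail := (Rtrace_tail Psi).
Local Notation tr := (ptr Psi).

Lemma ptr_gen n : tr (gen_op n.+1 n) = 1.
Proof. exact: ptr_R. Qed.

Lemma ptr_gen_conj n (Z : 'M[B]_#|{: mindex n.+1}|) :
  tr (gen_op n.+1 n * emb Z * genV_op n.+1 n) = emb (tr Z).
Proof.
by apply: ptr_conj => //; [apply: mulmxV | apply: mulVmx | exact: R_hecke.1];
  apply: hecke_unitmx R_hecke.
Qed.

(** The R-trace of w Z w^(-1) R_1 ... R_j for w = R_1 ... R_{n+1}. For j at most n + 1, the factors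
    after Z multiply to R_{n+1}^(-1) ... R_{j+1}^(-1). *)
Definition conj_trace n j Z :=
  Rtail (gen_word n.+1 n.+1 * emb Z * (rev_prod (genV_op n.+1) n.+1 * gen_word n.+1 j)).

(** For these j the last generator occurs only in a conjugation of Z, so [ptr_gen_conj] traces out
    the last factor. *)
Lemma conj_traceS n j (Z : 'M[B]_#|{: mindex n.+2}|) : (j <= n.+1)%N ->
  conj_trace j Z = conj_trace j (tr Z).
Proof.
move=> jn; rewrite /conj_trace Rtrace_tail_ptr; congr (Rtail _).
have -> : gen_word n.+2 n.+2 = emb (gen_word n.+1 n.+1) * gen_op n.+2 n.+1.
  by rewrite -(gen_word_emb (leqnn n.+1)) /gen_word big_ord_recr.
rewrite [rev_prod _ _]/(genV_op n.+2 n.+1 * rev_prod (genV_op n.+2) n.+1).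
rewrite (rev_genV_emb (leqnn n.+1)) (gen_word_emb jn).
transitivity (tr (emb (gen_word n.+1 n.+1) *
    (gen_op n.+2 n.+1 * emb Z * genV_op n.+2 n.+1) *
    emb (rev_prod (genV_op n.+1) n.+1 * gen_word n.+1 j))).
  by rewrite (embM (rev_prod _ _)) !mulrA.
by rewrite ptr_embr ptr_embl ptr_gen_conj.
Qed.

Lemma conj_trace0 n (Z : 'M[B]_#|{: mindex n.+1}|) :
  conj_trace 0 Z = (Rtrace Psi Z)%:M.
Proof.
elim: n Z => [|n IH] Z; last by rewrite conj_traceS // IH [in RHS]Rtrace_ptr.
rewrite /conj_trace /gen_word !big_ord_recr !big_ord0 /= mul1r !mulr1.
by rewrite Rtrace_tail_ptr ptr_gen_conj Rtrace_tail0_emb -Rtrace_ptr.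
Qed.

Lemma gen_word_absorb n j (Z : 'M[B]_#|{: mindex n.+1}|) : (j <= n)%N ->
  (forall i, (i < n)%N -> gen_op n i * Z = a%:A *: Z) ->
  gen_word n j * Z = (a ^+ j)%:A *: Z.
Proof.
move=> jn GZ; elim: j jn => [|j IH] jn.
  by rewrite /gen_word big_ord0 mul1r !scale1r.
rewrite gen_wordS -mulrA GZ // mulr_mx_algZ IH ?(ltnW jn) //.
by rewrite scalerA mulr_algl scalerA -exprS.
Qed.

(** For j = n the words after Z cancel, the last generator of w has R-trace I, and Z absorbs the
    other n generators. For j < n the last factor of Z is traced out first; the partial trace keeps
    the antisymmetry used in the induction. *)
Lemma conj_trace_gt0 n j (Z : 'M[B]_#|{: mindex n.+1}|) : (j <= n)%N ->
  (forall i, (i < n)%N -> gen_op n i * Z = a%:A *: Z) ->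
  conj_trace j.+1 Z = (a ^+ j)%:A *: Rtail Z.
Proof.
elim: n j Z => [|n IH] j Z; rewrite leq_eqVlt => /predU1P[->|jn] GZ //;
  do ?[rewrite /conj_trace (gen_Vprod (@genV_opK _)) // mulr1 Rtrace_tail_ptr gen_wordS
    (gen_word_emb (leqnn _)) ptr_embr ptr_embl ptr_gen mulr1 gen_word_absorb //
    Rtrace_tailZ //].
rewrite conj_traceS // IH // => [|i ik]; first by rewrite -Rtrace_tail_ptr.
rewrite -ptr_embl emb_gen_op // GZ ?ptrZ //; exact: leqW.
Qed.

(** By [skew_productE] the same operator has the antisymmetrizer as its left factor, where it
    absorbs the generator. *)
Lemma gen_dec_antisym n i : (i < n)%N ->
  gen_op n i * (dec n 0 n * antisym n n) = a%:A *: (dec n 0 n * antisym n n).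
Proof.
move=> ik; rewrite -skew_productE /skew_product skew_symmetrizerE.
rewrite [gen_op n i * _]mulrA -[gen_op n i * _]liftmxM.
rewrite (asym_gl q0 q1 (hecke_gens_act_at q0 R_hecke n)) //.
by rewrite liftmxZ mx_algZl.
Qed.

Lemma skew_powerS n : skew_power q R Psi L n.+1 = Rtail (dec n 0 n * antisym n n).
Proof.
rewrite -skew_productE; case: n => // .
rewrite skew_productE /antisym liftmx1 mulr1 /dec_prod big_ord1 addn0.
by rewrite Rtrace_tail0_act1 /shift_mx dilate_mx0.
Qed.

Lemma dec_gen_word n : dec n.+1 0 n.+1 * gen_word n.+1 n.+1 =
  shift_op n.+1 n.+1 * gen_word n.+1 n.+1 * emb (dec n 0 n).
Proof.
rewrite -(dec_emb 0 (leqnn n)).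
have := @dec_prodSl _ (gen_op n.+1) (genV_op n.+1) n.+1 (shift_op n.+1)
  (gen_op_braid n.+1) (@gen_opV n.+1) (@genV_opK n.+1) (@shift_op_far n.+1) 0 n
  (ltnSn n).
by rewrite add0n.
Qed.

Lemma dec_antisym_cosets n (Z := dec n 0 n * antisym n n) :
  dec n.+1 0 n.+1 * ((qint q n.+2)%:A *: antisym n.+1 n.+1) =
  shift_op n.+1 n.+1 * \sum_(j < n.+2) ((-1) ^+ j * q ^+ (n.+1 - j))%:A *:
    (gen_word n.+1 n.+1 * emb Z * (rev_prod (genV_op n.+1) n.+1 * gen_word n.+1 j)).
Proof.
rewrite antisym_cosets (antisym_emb (leqnn n)).
rewrite (mulr_dec_assoc _ _ _ (dec_gen_word n)) -embM.
congr (_ * _); rewrite mulr_sumr mulr_sumr; apply: eq_bigr => j _.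
by rewrite !mulr_mx_algZ.
Qed.

Lemma skew_power_rec n :
  (qint q n.+2)%:A *: skew_power q R Psi L n.+2 =
  shift_mx n.+1 *m ((q ^+ n.+1)%:A *: (elem_sym q R Psi L n.+1)%:M
    - (qint q n.+1)%:A *: skew_power q R Psi L n.+1).
Proof.
rewrite !skew_powerS /elem_sym skew_productE.
rewrite -Rtrace_tailZ -mulr_mx_algZ dec_antisym_cosets Rtrace_tail_act1l.
have := @gen_dec_antisym n; move: (_ * antisym n n) => Z GZ; congr (_ *m _).
rewrite Rtrace_tail_sum.
transitivity (\sum_(j < n.+2) ((-1) ^+ j * q ^+ (n.+1 - j))%:A *: conj_trace j Z).
  by apply: eq_bigr => j _; rewrite Rtrace_tailZ.
rewrite big_ord_recl /= expr0 mul1r subn0 conj_trace0; congr (_ + _).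
(* After the shift of j by one, the coefficients (-1)^(j+1) q^(n-j) (-q^(-1))^j sum to -(n+1)_q. *)
rewrite -(qint_sum q0 q1) -scaleNr -scaleNr -sumrN scaler_suml scaler_suml.
apply: eq_bigr => j _; rewrite (conj_trace_gt0 (leq_ord j) GZ).
rewrite scalerA mulr_algl scalerA /bump add1n subSS exprS mulN1r.
by rewrite -!mulNr.
Qed.

(* L(q^{-2(s+k)}u) ... L(q^{-2s}u) *)
Fixpoint power s k : 'M[B]_N :=
  if k is k'.+1 then power s.+1 k' *m shift_mx s else shift_mx s.

Lemma powerSl s k : power s k.+1 = shift_mx (s + k.+1) *m power s k.
Proof.
elim: k s => [|k IH] s; first by rewrite addn1.
transitivity (power s.+1 k.+1 *m shift_mx s); first by [].
by rewrite IH addSnnS -mulmxA.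
Qed.

(** The reversed word, moved to the left of the last copy, turns it into L_1, which leaves the trace
    on the right; the last generator then has R-trace I. *)
Lemma Rtail_dec_rev n s : Rtail (dec n s n * rev_prod (gen_op n) n) = power s n.
Proof.
elim: n s => [|n IH] s.
  by rewrite mulr1 /dec_prod big_ord1 addn0 Rtrace_tail0_act1.
have cr j : (j <= n.+1)%N ->
    barred (gen_op n.+1) (genV_op n.+1) (shift_op n.+1) j s * rev_prod (gen_op n.+1) j =
    rev_prod (gen_op n.+1) j * shift_op n.+1 s.
  elim: j => [|j IHj] jn; first by rewrite mulr1 mul1r.
  rewrite [rev_prod _ _]/(gen_op n.+1 j * rev_prod (gen_op n.+1) j) mulrA.
  by rewrite -(barredS _ (@genV_opK n.+1)) // -mulrA IHj ?(ltnW jn) // mulrA.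
rewrite dec_prodSr -mulrA cr // dec_emb //.
rewrite [rev_prod _ _]/(gen_op n.+1 n * rev_prod (gen_op n.+1) n) rev_gen_emb //.
rewrite mulrA Rtrace_tail_act1r mulrA Rtrace_tail_ptr ptr_embr ptr_embl ptr_gen mulr1.
by rewrite IH.
Qed.

Lemma rev_prodE (H : pzRingType) (h : nat -> H) k :
  rev_prod h k = \prod_(i < k) h (k - i.+1)%N.
Proof.
elim: k => [|k IH]; first by rewrite big_ord0.
by rewrite big_ord_recl subn1 /= IH.
Qed.

Lemma matrix_powerE k : matrix_power q R Psi L k.+1 = power 0 k.
Proof.
rewrite -Rtail_dec_rev /matrix_power; congr (Rtail (_ * _)).
  rewrite big_add1 big_mkord; apply: eq_bigr => j _.
  by rewrite subSS -[dilate_mx _ L]/(shift_mx (k - j)) LbarE.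
rewrite big_add1 big_mkord rev_prodE; apply: eq_bigr => j _.
by rewrite /gen_op /gen subSS subnSK.
Qed.

Lemma dilate_power p s k : dilate_mx (q ^- (2 * p)) (power s k) = power (p + s) k.
Proof.
elim: k s => [|k IH] s /=; first exact: dilate_mxD.
pose F : {rmorphism B -> B} := @fps_dilate K A (q ^- (2 * p)).
rewrite [LHS](map_mxM F) -addnS -IH; congr (_ *m _); exact: dilate_mxD.
Qed.

(** Induction on k by [skew_power_rec]: its elementary symmetric term is the new last summand, and
    its other term is the induction hypothesis multiplied on the left by one more copy of L. *)
Theorem cayley_hamilton_newton k : (0 < k)%N ->
  ((-1) ^+ k.+1 * qint q k)%:A *: skew_power q R Psi L k =
  \sum_(p < k)
    ((- q) ^+ p)%:A *:
      (dilate_mx (q ^- (2 * p)) (matrix_power q R Psi L (k - p)) *m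
       (elem_sym q R Psi L p)%:M).
Proof.
case: k => // k _.
transitivity (\sum_(p < k.+1) ((- q) ^+ p)%:A *:
  (power p (k - p) *m (elem_sym q R Psi L p)%:M)); last first.
  by apply: eq_bigr => p _; rewrite subSn ?leq_ord // matrix_powerE dilate_power addn0.
elim: k => [|k IH].
  rewrite big_ord1 expr2 mulN1r opprK (qint1 q0 q1) mulr1 expr0 /= !scale1r.
  by rewrite mulmx1 /shift_mx dilate_mx0.
have algA x y (Y : 'M[B]_N) : x%:A *: (y%:A *: Y) = (x * y)%:A *: Y.
  by rewrite scalerA mulr_algl scalerA.
rewrite -algA skew_power_rec -mx_algZr scalerBr !algA.
(* The leftmost argument index p + (k + 1 - p) does not depend on p, so one common factor can be
   taken out of the sum. *)
have powE (p : 'I_k.+1) : power p (k.+1 - p) = shift_mx k.+1 *m power p (k - p).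
  by rewrite subSn ?leq_ord // powerSl -subSn ?leq_ord // subnKC // ltnW.
rewrite [RHS]big_ord_recr /= subnn.
under [Y in _ = Y + _]eq_bigr => p _ do rewrite powE -mulmxA -mx_algZr.
rewrite -mulmx_sumr -IH -mx_algZr -mulmxDr addrC; congr (_ *m (_ + _)).
  by rewrite -scaleNr -scaleNr -mulNr exprS mulN1r opprK.
by rewrite [in RHS]exprNn 2!exprS !mulN1r opprK.
Qed.

End Yang.

Theorem proposition23 (K : fieldType) (N : nat) (q : K)
    (R Psi : 'M[K]_(N * N))
    (q_neq0 : q != 0) (q_generic : forall n : int, n != 0 -> q ^ n != 1)
    (R_hecke : hecke_symmetry q R) (R_skew_inv : skew_inverse R Psi)
    (k : nat) (k_gt0 : (0 < k)%N) :
  let L : 'M[fps (yangian q R)]_N := yangian_mx q R in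
  ((-1) ^+ k.+1 * qint q k)%:A *: skew_power q R Psi L k =
  \sum_(p < k)
    ((- q) ^+ p)%:A *:
      (dilate_mx (q ^- (2 * p)) (matrix_power q R Psi L (k - p)) *m
       (elem_sym q R Psi L p)%:M).
Proof.
exact: (cayley_hamilton_newton q_neq0 q_generic R_hecke R_skew_inv (yangian_mxP q R)).
Qed.
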